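(* $\Pi_*$ is not homeomorphic to $(\Pi_*/\mathbb{R}_+)\times\mathbb{R}_+$.
   Context: mm-spaces are triples $(X,d_X,\mu_X)$ with $(X,d_X)$ complete separable metric and $\mu_X$ a Borel probability measure, with $X=\operatorname{supp}\mu_X$. $\mathcal{X}$ is the set of their isomorphism classes under measure-preserving isometries of supports. Box distance: $\square(X,Y)$ is the infimum of $\varepsilon\ge0$ such that there exist Borel maps $\varphi,\psi$ from $[0,1)$ pushing Lebesgue measure to $\mu_X,\mu_Y$ and a Borel $I_0$ of measure $\ge1-\varepsilon$ with $|d_X(\varphi(s),\varphi(t))-d_Y(\psi(s),\psi(t))|\le\varepsilon$ on $I_0$. $Y\prec X$ means there is a 1-Lipschitz $f\colon X\to Y$ with $f_*\mu_X=\mu_Y$. A pyramid is a nonempty $\square$-closed subset of $\mathcal{X}$ that is downward closed under $\prec$ and such that any two elements are dominated by a common element. $\Pi$ is the set of pyramids with the (metrizable, compact) topology of weak convergence: $\mathcal{P}_n\to\mathcal{P}$ iff $\square(X,\mathcal{P}_n)\to0$ for $X\in\mathcal{P}$ and $\liminf\square(X,\mathcal{P}_n)>0$ for $X\notin\mathcal{P}$. $\mathbb{R}_+$ acts on $\Pi$ by $t\mathcal{P}=\{(X,t\,d_X,\mu_X):X\in\mathcal{P}\}$. $\Pi_*=\Pi\setminus\mathrm{Fix}(\Pi)$, and $\Pi_*/\mathbb{R}_+$ has the quotient topology. *)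

(* Defs.v *)
From HB Require Import structures.
From mathcomp Require Import all_boot all_order all_algebra.
From mathcomp Require Import all_classical all_reals all_analysis.
Set Implicit Arguments. Unset Strict Implicit. Unset Printing Implicit Defensive.
Import Order.TTheory GRing.Theory Num.Theory.
Import numFieldNormedType.Exports.
Local Open Scope classical_set_scope.
Local Open Scope ring_scope.

Section MM.
Variable R : realType.

Definition is_metric (T : Type) (d : T -> T -> R) : Prop :=
  [/\ forall x y, 0 <= d x y,
      forall x y, d x y = 0 <-> x = y,
      forall x y, d x y = d y x &
      forall x y z, d x z <= d x y + d y z].

Definition complete_metric (T : Type) (d : T -> T -> R) : Prop :=
  forall u : nat -> T,
    (forall e, 0 < e -> exists N, forall m n, (N <= m)%N -> (N <= n)%N -> d (u m) (u n) < e) ->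
    exists x, forall e, 0 < e -> exists N, forall n, (N <= n)%N -> d (u n) x < e.

Definition separable_metric (T : Type) (d : T -> T -> R) : Prop :=
  exists u : nat -> T, forall x e, 0 < e -> exists n, d x (u n) < e.

Definition mball (T : Type) (d : T -> T -> R) (x : T) (r : R) : set T :=
  [set y | d x y < r].

Definition mopen (T : Type) (d : T -> T -> R) (U : set T) : Prop :=
  forall x, U x -> exists2 r, 0 < r & mball d x r `<=` U.

Definition mborel (T : Type) (d : T -> T -> R) : set (set T) :=
  smallest (sigma_algebra setT) (mopen d).

Definition borel_probability (T : Type) (d : T -> T -> R)
    (mu : set T -> \bar R) : Prop :=
  [/\ mu set0 = 0%E,
      (forall B, mborel d B -> (0 <= mu B)%E),
      (forall F : nat -> set T, (forall n, mborel d (F n)) ->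
         trivIset setT F ->
         (fun n => \sum_(0 <= i < n) mu (F i))%E @ \oo --> mu (\bigcup_n F n)) &
      mu setT = 1%E].

Record mmspace := MMSpace {
  mm_T :> Type;
  mm_d : mm_T -> mm_T -> R;
  mm_mu : set mm_T -> \bar R;
  mm_is_metric : is_metric mm_d;
  mm_complete : complete_metric mm_d;
  mm_separable : separable_metric mm_d;
  mm_prob : borel_probability mm_d mm_mu;
  mm_full_support : forall x r, 0 < r -> (0 < mm_mu (mball mm_d x r))%E }.

Definition I01 : set R := [set s | 0 <= s < 1].

Definition parametrization (X : mmspace) (phi : R -> X) : Prop :=
  forall B, mborel (mm_d (m:=X)) B ->
    measurable (I01 `&` phi @^-1` B) /\
    (@lebesgue_measure R) (I01 `&` phi @^-1` B) = mm_mu B.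

Definition box_adm (X Y : mmspace) (e : R) : Prop :=
  0 <= e /\
  exists (phi : R -> X) (psi : R -> Y) (I0 : set R),
    [/\ parametrization phi /\ parametrization psi,
        I0 `<=` I01, measurable I0,
        ((1 - e)%:E <= (@lebesgue_measure R) I0)%E &
        forall s t, I0 s -> I0 t ->
          `|mm_d (phi s) (phi t) - mm_d (psi s) (psi t)| <= e].

Definition box (X Y : mmspace) : R := inf (box_adm X Y).

Definition boxP (X : mmspace) (P : set mmspace) : R :=
  inf [set box X Y | Y in P].

Definition dominated (Y X : mmspace) : Prop :=
  exists f : X -> Y,
    (forall x x', mm_d (f x) (f x') <= mm_d x x') /\
    (forall B, mborel (mm_d (m:=Y)) B -> mm_mu (f @^-1` B) = mm_mu B).

Definition box_closed (P : set mmspace) : Prop :=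
  forall X, (forall e, 0 < e -> exists2 Y, P Y & box X Y < e) -> P X.

Definition is_pyramid (P : set mmspace) : Prop :=
  [/\ exists X, P X,
      box_closed P,
      (forall X Y, P X -> dominated Y X -> P Y) &
      (forall X X', P X -> P X' ->
         exists2 Y, P Y & dominated X Y /\ dominated X' Y)].

Definition pyramid := {P : set mmspace | is_pyramid P}.

Definition pconv (Pn : nat -> pyramid) (P : pyramid) : Prop :=
  (forall X, sval P X -> (fun n => boxP X (sval (Pn n))) @ \oo --> 0) /\
  (forall X, ~ sval P X ->
     (0 < limn_einf (fun n => (boxP X (sval (Pn n)))%:E))%E).

(** The topology of weak convergence on Pi (Pi is metrizable, so its
    topology is the sequential topology determined by pconv). *)
Definition pyr_closed (A : set pyramid) : Prop :=
  forall (Pn : nat -> pyramid) (P : pyramid),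
    (forall n, A (Pn n)) -> pconv Pn P -> A P.

Definition pyr_open (U : set pyramid) : Prop := pyr_closed (~` U).

Definition mm_dilate (t : R) (X Y : mmspace) : Prop :=
  exists f : X -> Y,
    [/\ bijective f,
        (forall x x', mm_d (f x) (f x') = t * mm_d x x') &
        (forall B, mborel (mm_d (m:=Y)) B -> mm_mu (f @^-1` B) = mm_mu B)].

(** Q = t P  (as subsets of the isomorphism classes). *)
Definition pyr_scale_eq (t : R) (P Q : pyramid) : Prop :=
  forall Y, sval Q Y <-> exists2 X, sval P X & mm_dilate t X Y.

Definition pyr_fixed (P : pyramid) : Prop :=
  forall t, 0 < t -> pyr_scale_eq t P P.

Definition pyr_star := {P : pyramid | ~ pyr_fixed P}.

Definition star_open (V : set pyr_star) : Prop :=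
  exists2 U, pyr_open U & V = [set P | U (sval P)].

Definition orbit (P : pyr_star) : set pyr_star :=
  [set Q | exists2 t, 0 < t & pyr_scale_eq t (sval P) (sval Q)].

Definition pyr_quot := {C : set pyr_star | exists P, C = orbit P}.

Definition quot_proj (P : pyr_star) : pyr_quot :=
  exist _ (orbit P) (ex_intro _ P erefl).

Definition quot_open (W : set pyr_quot) : Prop :=
  star_open (quot_proj @^-1` W).

Definition Rpos := {t : R | 0 < t}.

Definition prod_open (W : set (pyr_quot * Rpos)) : Prop :=
  forall q t, W (q, t) ->
    exists V : set pyr_quot, exists O : set R,
      [/\ quot_open V, open O, V q, O (sval t) &
          forall q' t', V q' -> O (sval t') -> W (q', t')].

Definition homeomorphic_star_prod : Prop :=
  exists (h : pyr_star -> pyr_quot * Rpos) (g : pyr_quot * Rpos -> pyr_star),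
    [/\ cancel h g, cancel g h,
        (forall W, prod_open W -> star_open (h @^-1` W)) &
        (forall V, star_open V -> prod_open (g @^-1` V))].

End MM.

(* Main.v *)
Require Import Defs.
From HB Require Import structures.
From mathcomp Require Import all_boot all_order all_algebra.
From mathcomp Require Import all_classical all_reals all_analysis.
From mathcomp Require Import ring lra.
Set Implicit Arguments. Unset Strict Implicit. Unset Printing Implicit Defensive.
Import Order.TTheory GRing.Theory Num.Theory.
Import numFieldNormedType.Exports.
Local Open Scope classical_set_scope.
Local Open Scope ring_scope.

(* The quotient is not Hausdorff, whereas in [Pi_*] sequences have unique limits.
   Let P_n be the pyramid of the three-point space of equal masses with two
   points at distance 1 and the third at distance n from both. As n grows, P_n
   converges to the pyramid P of the same space with the far distance made
   infinite, while (1/n) P_n converges to the pyramid Q of a two-point space;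
   P and Q lie in different orbits, so the orbits of P_n converge to two
   distinct points. A homeomorphism would turn the slice at height 1 over this
   sequence into a sequence of [Pi_*] with two limits.

   Limits are handled without the triangle inequality for the box distance:
   closedness of the pyramids of finite spaces follows from a pigeonhole
   argument, once every mm-space is known to admit a parametrization. *)

(** * Simulating a sequence of events by subsets of the unit interval *)

(** A single distance would not do: rescaling moves a two-point space within one orbit. Two
    distances whose ratio tends to infinity leave a choice of which one to normalise, and each
    choice has its own limit. The limits are separated by diameter: [P] has members of arbitrarily
    large diameter, while those of [t Q] have diameter at most [t]. A triangle inequality for [box]
    would require gluing two parametrizations of the middle space; each estimate below compares one
    pair of spaces only. The other obstacle is that a homeomorphism transports open sets, whereas
    weak convergence is given by sequences and no metric on pyramids is at hand. Uniqueness of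
    limits is therefore lifted from [pconv] to convergence in the sense of [pyr_open] by extracting
    subsequences. *)

Section Realize.
Context (d : measure_display) (T : measurableType d) (R : realType).
Variables (P : probability T R) (E : nat -> set T).
Hypothesis mE : forall j, measurable (E j).

(* A word of answers to the questions x \in E j, last answer first, cuts out the
   cylinder [cyl w]; the intervals [itvw w] of length [P (cyl w)] are nested in
   the same way. *)
Fixpoint cyl (w : seq bool) : set T :=
  if w is b :: w' then cyl w' `&` (if b then E (size w') else ~` E (size w'))
  else setT.

Definition mid (lo : R) (w : seq bool) := lo + fine (P (cyl w `&` E (size w))).

Fixpoint lo (w : seq bool) : R :=
  if w is b :: w' then (if b then lo w' else mid (lo w') w') else 0.

Definition hi w := lo w + fine (P (cyl w)).

Definition itvw w : set R := [set s | lo w <= s < hi w].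

Fixpoint code (s : R) (n : nat) : seq bool :=
  if n is m.+1 then (s < mid (lo (code s m)) (code s m)) :: code s m else [::].

(** The copy of [E j] in the unit interval: the points whose answer to question [j] is yes. *)
Definition digit_set j : set R :=
  [set s | 0 <= s < 1 /\ s < mid (lo (code s j)) (code s j)].

Lemma measurable_cyl w : measurable (cyl w).
Proof.
elim: w => [|[] w IH] /=; first exact: measurableT.
- exact: measurableI.
- by apply: measurableI => //; exact: measurableC.
Qed.

Lemma size_code s n : size (code s n) = n.
Proof. by elim: n => //= n ->. Qed.

Lemma fineP_fin A : measurable A -> (fine (P A))%:E = P A.
Proof. by move=> mA; rewrite fineK// fin_num_measure. Qed.

Lemma fineP_ge0 A : 0 <= fine (P A).
Proof. exact: fine_ge0. Qed.

Lemma hi_true w : hi (true :: w) = mid (lo w) w.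
Proof. by []. Qed.

Lemma hi_false w : hi (false :: w) = hi w.
Proof.
rewrite /hi/= /mid -addrA; congr (_ + _).
apply: EFin_inj; rewrite EFinD !fineP_fin//; last 3 first.
- exact: measurable_cyl.
- by apply: measurableI; [exact: measurable_cyl|exact: measurableC].
- by apply: measurableI; [exact: measurable_cyl|].
rewrite addeC -setDE; apply/esym/measureDI => //; exact: measurable_cyl.
Qed.

Lemma mid_bounds w : lo w <= mid (lo w) w <= hi w.
Proof.
rewrite lerDl fineP_ge0 lerD2l/= fine_le//.
- by rewrite fin_num_measure//; apply: measurableI => //; exact: measurable_cyl.
- by rewrite fin_num_measure//; exact: measurable_cyl.
- by apply: measureIl => //; exact: measurable_cyl.
Qed.

Lemma itvw_cons b w s :
  itvw (b :: w) s <-> itvw w s /\ (s < mid (lo w) w) = b.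
Proof.
have /andP[h1 h2] := mid_bounds w.
rewrite /itvw/=; case: b; rewrite ?hi_true ?hi_false/=; split.
- by move=> /andP[-> h]; rewrite h (lt_le_trans h h2).
- by move=> [/andP[-> _] ->].
- by move=> /andP[h ->]; rewrite (le_trans h1 h) ltNge h.
- by move=> [/andP[_ ->]]; rewrite ltNge => /negbFE ->.
Qed.

Lemma itvw_nil s : itvw [::] s <-> 0 <= s < 1.
Proof. by rewrite /itvw/= /hi/= probability_setT/= add0r. Qed.

Lemma itvw_code s n : 0 <= s < 1 -> itvw (code s n) s.
Proof.
move=> s01; elim: n => [|n IH]; first by apply/itvw_nil.
by apply/itvw_cons.
Qed.

Lemma code_itvw s w : itvw w s -> code s (size w) = w.
Proof. by elim: w => //= b w IH /itvw_cons[/IH -> ->]. Qed.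

Lemma itvw_01 s w : itvw w s -> 0 <= s < 1.
Proof. by elim: w => [/itvw_nil//|b w IH /itvw_cons[/IH]]. Qed.

(** A word longer than [j] contains the answer to question [j], which settles interval and cylinder
    in the same way. *)
Lemma decided w j : (j < size w)%N ->
  (itvw w `<=` digit_set j /\ cyl w `<=` E j) \/
  (itvw w `<=` ~` digit_set j /\ cyl w `<=` ~` E j).
Proof.
elim: w => //= b w IH; rewrite ltnS leq_eqVlt => /predU1P[->|jw].
- case: b; [left|right]; split.
  + move=> s /itvw_cons[sw h]; split; first exact: itvw_01 sw.
    by rewrite (code_itvw sw).
  + by move=> x [].
  + move=> s /itvw_cons[sw h] [_]; rewrite (code_itvw sw) h//.
  + by move=> x [].
- have [[h1 h2]|[h1 h2]] := IH jw; [left|right]; split.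
  + by move=> s /itvw_cons[/h1].
  + by move=> x [/h2].
  + by move=> s /itvw_cons[/h1].
  + by move=> x [/h2].
Qed.

Lemma measurable_itvw w : measurable (itvw w).
Proof.
have -> : itvw w = `[lo w, hi w[%classic by apply/seteqP; split => s; rewrite /= in_itv.
exact: measurable_itv.
Qed.

Lemma itvw_measure w : lebesgue_measure (itvw w) = P (cyl w).
Proof.
have -> : itvw w = `[lo w, hi w[%classic by apply/seteqP; split => s; rewrite /= in_itv.
rewrite lebesgue_measure_itv/= lte_fin /hi ltrDl.
have mw := measurable_cyl w; rewrite -(fineP_fin mw).
case: ltP; first by rewrite -EFinB addrC addKr.
move=> h; congr EFin; apply/eqP; rewrite eq_le h andbT.
exact: fineP_ge0.
Qed.

Lemma measurable_digit_set j : measurable (digit_set j).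
Proof.
have -> : digit_set j = \bigcup_(w : j.-tuple bool) itvw (true :: w).
  apply/seteqP; split => [s [s01 h]|s [w _ sw]].
    exists (tcast (size_code s j) (in_tuple (code s j))) => //=.
    by rewrite val_tcast; apply/itvw_cons; split=> //; exact: itvw_code.
  split; first exact: itvw_01 sw.
  by move/itvw_cons: sw => [/code_itvw]; rewrite size_tuple => -> ->.
apply: countable_bigcupT_measurable => [|w]; first exact: countableP.
exact: measurable_itvw.
Qed.

Let cupA (p : pred nat) n := \bigcup_(j in [set j | (j < n)%N && p j]) digit_set j.
Let cupE (p : pred nat) n := \bigcup_(j in [set j | (j < n)%N && p j]) E j.

Let mcupA p n : measurable (cupA p n).
Proof. by apply: bigcup_measurable => j _; exact: measurable_digit_set. Qed.

Let mcupE p n : measurable (cupE p n).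
Proof. by apply: bigcup_measurable => j _. Qed.

Lemma itvw_split w : itvw w = itvw (true :: w) `|` itvw (false :: w).
Proof.
apply/seteqP; split => s; last by case=> /itvw_cons[].
move=> sw; case h : (s < mid (lo w) w); [left|right]; exact/itvw_cons.
Qed.

Lemma itvw_disj w A : (itvw (true :: w) `&` A) `&` (itvw (false :: w) `&` A) = set0.
Proof.
by apply/seteqP; split => // s [[/itvw_cons[_ h] _] [/itvw_cons[_]]]; rewrite h.
Qed.

(** Induction on [n - size w]: a word of length [n] decides all events below [n], so each
    intersection is everything or empty; a shorter word splits into its two extensions, over which
    both measures add. *)
Let cup_w p n w : (size w <= n)%N ->
  lebesgue_measure (itvw w `&` cupA p n) = P (cyl w `&` cupE p n).
Proof.
move=> /subnK; move: (n - size w)%N => k; elim: k w => [|k IH] w.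
  rewrite add0n => wn.
  have [[j /andP[jn pj] [h1 h2]]|H] := pselect (exists2 j, (j < n)%N && p j &
      (itvw w `<=` digit_set j /\ cyl w `<=` E j)).
    rewrite !setIidl; first exact: itvw_measure.
      by move=> x /h2; exists j => //=; rewrite jn.
    by move=> x /h1; exists j => //=; rewrite jn.
  have [-> ->] : (itvw w `&` cupA p n = set0) /\ (cyl w `&` cupE p n = set0).
    split; apply/seteqP; split => // x [xw [j /= /andP[jn pj] xj]];
      have jw : (j < size w)%N by rewrite ?wn.
      have [h|[h _]] := decided jw.
        by apply: H; exists j => //; rewrite jn.
      exact: h xj.
    have [h|[_ h]] := decided jw.
      by apply: H; exists j => //; rewrite jn.
    exact: h xj.
  by rewrite !measure0.
rewrite addSn => wn.
rewrite itvw_split setIUl measureU ?itvw_disj//; last 2 first.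
- by apply: measurableI; [exact: measurable_itvw|exact: mcupA].
- by apply: measurableI; [exact: measurable_itvw|exact: mcupA].
transitivity (P (cyl (true :: w) `&` cupE p n) + P (cyl (false :: w) `&` cupE p n))%E.
  by congr (_ + _)%E; apply: IH; rewrite /= addnS.
rewrite -measureU /=.
- by congr (P _); rewrite -setIUl -setIUr setUv setIT.
- do 2 apply: measurableI => //; exact: measurable_cyl.
- by apply: measurableI => //; apply: measurableI;
    [exact: measurable_cyl|exact: measurableC].
- by apply/seteqP; split => // x [[[_ h] _] [[_]]].
Qed.

(** Finite unions come from [cup_w] at the empty word, infinite ones from continuity of both
    measures from below. *)
Lemma digit_set_cup (p : pred nat) :
  lebesgue_measure (\bigcup_(j in [set j | p j]) digit_set j) =
  P (\bigcup_(j in [set j | p j]) E j).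
Proof.
have bE (U : Type) (F : nat -> set U) : \bigcup_(j in [set j | p j]) F j =
    \bigcup_n \bigcup_(j in [set j | (j < n)%N && p j]) F j.
  apply/seteqP; split => [s [j pj sj]|s [n _ [j /andP[_ pj] sj]]].
    by exists j.+1 => //; exists j => //=; rewrite ltnSn.
  by exists j.
have nd (U : Type) (F : nat -> set U) : nondecreasing_seq
   (fun n => \bigcup_(j in [set j | (j < n)%N && p j]) F j).
  move=> m n mn; apply/subsetPset => s [j /= /andP[jm pj] sj]; exists j => //=.
  by rewrite (leq_trans jm mn).
rewrite !bE.
have h1 := @nondecreasing_cvg_mu _ _ _ (@lebesgue_measure R) _ (mcupA p)
  (bigcupT_measurable _ (mcupA p)) (nd _ digit_set).
have h2 := @nondecreasing_cvg_mu _ _ _ P _ (mcupE p)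
  (bigcupT_measurable _ (mcupE p)) (nd _ E).
have e : (@lebesgue_measure R) \o cupA p = P \o cupE p.
  apply/funext => n /=; have := @cup_w p n [::] (leq0n _).
  rewrite /= setTI => <-; congr lebesgue_measure.
  rewrite setIidr// => s [j _ [s01 _]]; exact/itvw_nil.
apply: (cvg_unique _ h1) => //=.
by move: h2; rewrite -e.
Qed.

(** An interval [itvw w] containing a point has positive length, so [cyl w] has positive mass and is
    inhabited; [w] is taken long enough to decide both events. *)
Lemma digit_set_meet i j s : digit_set i s -> digit_set j s ->
  E i `&` E j !=set0.
Proof.
move=> si sj; have s01 : 0 <= s < 1 by case: si.
pose n := (maxn i j).+1; pose w := code s n.
have sw : itvw w s by exact: itvw_code.
have [x wx] : cyl w !=set0.
  apply/set0P/eqP => w0; move: sw => /andP[h1 /(le_lt_trans h1)].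
  by rewrite /hi w0 measure0 addr0 ltxx.
have [iw jw] : (i < size w)%N /\ (j < size w)%N.
  by rewrite size_code !ltnS leq_maxl leq_maxr.
exists x; split.
- by have [[_]|[/(_ _ sw)]] := decided iw; [exact|].
- by have [[_]|[/(_ _ sw)]] := decided jw; [exact|].
Qed.

End Realize.

(** * Borel sets and parametrizations of mm-spaces *)

Section Borel.
Context {R : realType}.

Lemma mborel_sigma (T : Type) (d : T -> T -> R) :
  sigma_algebra setT (mborel d).
Proof. exact: smallest_sigma_algebra. Qed.

Lemma mopen_mborel (T : Type) (d : T -> T -> R) U : mopen d U -> mborel d U.
Proof. exact: sub_sigma_algebra. Qed.

Lemma mborelC (T : Type) (d : T -> T -> R) A : mborel d A -> mborel d (~` A).
Proof. by case: (mborel_sigma d) => _ h _ /h; rewrite setTD. Qed.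

Lemma mopen_mball (T : Type) (d : T -> T -> R) x r :
  is_metric d -> mopen d (mball d x r).
Proof.
move=> [_ _ _ tri] y xy; exists (r - d x y); first by rewrite subr_gt0.
move=> z; rewrite /mball/= => yz.
by rewrite (le_lt_trans (tri x y z))// addrC -ltrBrDr.
Qed.

Lemma mborel_mball (T : Type) (d : T -> T -> R) x r :
  is_metric d -> mborel d (mball d x r).
Proof. by move=> h; apply: mopen_mborel; exact: mopen_mball. Qed.

Lemma mball_center (T : Type) (d : T -> T -> R) x r :
  is_metric d -> 0 < r -> mball d x r x.
Proof. by move=> [_ h _ _] r0; rewrite /mball/= (iffRL (h x x)). Qed.

Lemma mopenI (T : Type) (d : T -> T -> R) U V :
  mopen d U -> mopen d V -> mopen d (U `&` V).
Proof.
move=> oU oV x [/oU[r r0 rU] /oV[s s0 sV]].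
exists (Num.min r s); first by rewrite lt_min r0.
by move=> y; rewrite /mball/= lt_min => /andP[/rU ? /sV ?]; split.
Qed.

Lemma mborel_preimage (T U : Type) (d : T -> T -> R) (d' : U -> U -> R)
    (f : T -> U) (c : R) : 0 < c ->
  (forall x y, d' (f x) (f y) <= c * d x y) ->
  forall B, mborel d' B -> mborel d (f @^-1` B).
Proof.
move=> c0 fc.
have [s0 sC sU] := mborel_sigma d.
suff : mborel d' `<=` [set B | mborel d (f @^-1` B)] by [].
apply: smallest_sub; first split => //=.
- by move=> A mA; rewrite setTD preimage_setC; exact: mborelC.
- by move=> F mF; rewrite preimage_bigcup; exact: sU.
move=> V oV; apply: mopen_mborel => x /oV[r r0 rV].
exists (r / c); first exact: divr_gt0.
move=> y; rewrite /mball/= ltr_pdivlMr// => xy; apply: rV.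
by rewrite /mball/= (le_lt_trans (fc _ _))// mulrC.
Qed.

End Borel.

Section Space.
Context {R : realType} (X : mmspace R).
Notation d := (@mm_d R X).

Lemma mm_inhabited : exists x : X, True.
Proof.
have [mu0 _ _ mu1] := mm_prob X.
have [[x _]|h] := pselect (exists x : X, True); first by exists x.
have E : [set: X] = set0 by apply/seteqP; split => // x _; apply: h; exists x.
by move: mu1; rewrite E mu0 => /esym/eqP; rewrite onee_eq0.
Qed.

Definition mmT : Type := X.
HB.instance Definition _ := gen_eqMixin mmT.
HB.instance Definition _ := gen_choiceMixin mmT.
HB.instance Definition _ := isPointed.Build mmT (sval (cid mm_inhabited)).

Definition mmB := g_sigma_algebraType (mopen d : set (set mmT)).
HB.instance Definition _ := Measurable.on mmB.

(* [mm_mu] is unconstrained off the Borel sets, hence the truncation. *)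
Definition mm_measure (A : set mmB) : \bar R :=
  if `[< mborel d A >] then mm_mu A else 0%E.

Lemma mm_measureE A : mborel d A -> mm_measure A = mm_mu A.
Proof. by move=> h; rewrite /mm_measure asboolT. Qed.

Lemma mm_measure0 : mm_measure set0 = 0%E.
Proof. by rewrite /mm_measure; case: asboolP => //; have [] := mm_prob X. Qed.

Lemma mm_measure_ge0 A : (0 <= mm_measure A)%E.
Proof.
by rewrite /mm_measure; case: asboolP => // h; have [_ h' _ _] := mm_prob X; apply: h'.
Qed.

Lemma mm_measure_sigma_additive : semi_sigma_additive mm_measure.
Proof.
move=> F mF tF mU; rewrite mm_measureE//.
have [_ _ h _] := mm_prob X.
under eq_fun do under eq_bigr do rewrite (mm_measureE (mF _)).
exact: h.
Qed.

HB.instance Definition _ := isMeasure.Build _ mmB R mm_measure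
  mm_measure0 mm_measure_ge0 mm_measure_sigma_additive.

Lemma mm_measureT : mm_measure setT = 1%E.
Proof.
rewrite mm_measureE; first by have [_ _ _ ->] := mm_prob X.
exact: (@measurableT _ mmB).
Qed.

HB.instance Definition _ := Measure_isProbability.Build _ mmB R mm_measure mm_measureT.

Lemma mm_prob_exists : exists P : probability mmB R,
  forall A, mborel d A -> P A = mm_mu A.
Proof. exists mm_measure; exact: mm_measureE. Qed.

End Space.

Section Parametrization.
Context {R : realType} (X : mmspace R).
Local Notation d := (@mm_d R X).
Local Notation lebesgue := (@lebesgue_measure R).

Lemma half_pow_gt0 k : 0 < (2^-1 : R) ^+ k.
Proof. by rewrite exprn_gt0// invr_gt0. Qed.

Lemma half_pow_lt (e : R) : 0 < e -> exists k, 2^-1 ^+ k < e.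
Proof.
move=> e0; pose n := Num.truncn e^-1.
have h : e^-1 < n.+1%:R by rewrite /n truncnS_gt.
exists n.+1; rewrite exprVn -(invrK e) ltf_pV2 ?posrE ?invr_gt0 ?exprn_gt0//.
rewrite (lt_le_trans h)// -natrX ler_nat ltnW// ltn_expl//.
Qed.

Lemma I01_measure : lebesgue (@I01 R) = 1%E.
Proof.
have -> : @I01 R = `[0, 1[%classic by apply/seteqP; split => s; rewrite /= in_itv.
by rewrite lebesgue_measure_itv/= lte01 sube0.
Qed.

Lemma measurable_I01 : measurable (@I01 R).
Proof.
have -> : @I01 R = `[0, 1[%classic by apply/seteqP; split => s; rewrite /= in_itv.
exact: measurable_itv.
Qed.

Lemma measure_I01_fin (A : set R) : measurable A -> A `<=` @I01 R ->
  (lebesgue A < +oo)%E.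
Proof.
move=> mA AI; have : (lebesgue A <= 1)%E.
  by rewrite -I01_measure le_measure ?inE//; exact: measurable_I01.
by move/le_lt_trans; apply; rewrite ltry.
Qed.

Lemma lebesgue_I01D (A : set R) : measurable A -> A `<=` @I01 R ->
  lebesgue (@I01 R `\` A) = (1 - lebesgue A)%E.
Proof.
move=> mA AI; have := @measureD _ _ _ (@lebesgue_measure R) _ _ measurable_I01 mA.
by rewrite /= setIidr// I01_measure; apply; rewrite ltry.
Qed.

(* A Borel set is the union of those balls of a countable base lying well inside
   it, so matching the masses of unions of balls suffices on open sets. *)
Lemma ball_simulation (u : nat -> X) :
  exists A : nat * nat -> set R,
    [/\ forall z, measurable (A z) /\ A z `<=` @I01 R,
        forall q : pred (nat * nat),
          measurable (\bigcup_(z in [set z | q z]) A z) /\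
          lebesgue (\bigcup_(z in [set z | q z]) A z) =
          mm_mu (\bigcup_(z in [set z | q z]) mball d (u z.2) (2^-1 ^+ z.1)) &
        forall z z' s, A z s -> A z' s ->
          d (u z.2) (u z'.2) < 2^-1 ^+ z.1 + 2^-1 ^+ z'.1].
Proof.
have [P PE] := mm_prob_exists X.
have [_ _ dsym dtri] := mm_is_metric X.
pose B (z : nat * nat) := mball d (u z.2) (2^-1 ^+ z.1).
pose E j : set (mmB X) := if @pickle_inv (nat * nat)%type j is Some z then B z else set0.
have EB z : E (pickle z) = B z by rewrite /E pickleK_inv.
have mB z : mborel d (B z) by apply: mborel_mball; exact: mm_is_metric.
have mE j : measurable (E j).
  by rewrite /E; case: pickle_inv => [z|]; [exact: mB|exact: measurable0].
exists (fun z => digit_set P E (pickle z)); split.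
- move=> z; split; first exact: measurable_digit_set.
  by move=> s [].
- move=> q.
  pose p j := if @pickle_inv (nat * nat)%type j is Some z then q z else false.
  have bE (T : Type) (F : nat -> set T) : \bigcup_(z in [set z | q z]) F (pickle z)
      = \bigcup_(j in [set j | p j]) F j.
    apply/seteqP; split => [s [z qz sz]|s [j pj sj]].
      by exists (pickle z) => //=; rewrite /p pickleK_inv.
    move: pj; rewrite /= /p; have := @pickle_invK (nat * nat)%type j.
    case: pickle_inv => //= z zj qz; exists z => //; rewrite zj//.
  rewrite bE; split.
    by apply: bigcup_measurable => j _; exact: measurable_digit_set.
  rewrite (digit_set_cup P mE) -bE PE.
    by congr mm_mu; apply: eq_bigcupr => z _; rewrite EB.
  by rewrite bE; apply: (@bigcup_measurable _ (mmB X)) => j _.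
- move=> z z' s sz sz'.
  have [x []] := digit_set_meet mE sz sz'.
  rewrite !EB /B/mball/= => h1 h2.
  by rewrite (le_lt_trans (dtri _ x _))// ltrD// dsym.
Qed.

(** [phi s] is the limit of the centres of the simulated balls containing [s]. At each level [k] the
    balls of radius [2^-k] cover [X], so almost every [s] lies in one of each level; simulated balls
    sharing a point have close centres, and completeness yields the limit. The law of [phi] is
    checked on open sets, a generating family stable under intersection. *)
Lemma parametrization_exists : exists phi, parametrization (X := X) phi.
Proof.
have [u du] := mm_separable X.
have [A [mA muA Ameet]] := ball_simulation u.
have [d0 deq dsym dtri] := mm_is_metric X.
have [x0 _] := mm_inhabited X.
have e0 := half_pow_gt0.
pose good := [set s | @I01 R s /\ forall k, exists n, A (k, n) s].
have limit s : good s -> exists x, forall z, A z s -> d x (u z.2) <= 2^-1 ^+ z.1.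
  move=> [_ /choice[f Af]].
  have [|x xP] := @mm_complete _ X (u \o f).
    move=> e eP; have [k ke] : exists k, 2^-1 ^+ k < e / 2.
      by apply: half_pow_lt; rewrite divr_gt0.
    exists k => m n km kn /=.
    have := Ameet _ _ _ (Af m) (Af n) => /= /lt_le_trans; apply.
    have le j : (k <= j)%N -> (2^-1 : R) ^+ j <= 2^-1 ^+ k.
      by move=> kj; rewrite ler_wiXn2l// invf_le1// ler1n.
    have := le _ km; have := le _ kn; move: ke; lra.
  exists x => z zs; apply/ler_addgt0Pr => e eP.
  have [k ke] : exists k, 2^-1 ^+ k < e / 2.
    by apply: half_pow_lt; rewrite divr_gt0.
  have [N NP] := xP (e / 2) ltac:(by rewrite divr_gt0).
  pose n := maxn N k.
  have h1 := NP n (leq_maxl _ _).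
  have h2 := Ameet _ _ _ (Af n) zs; rewrite /= in h1 h2.
  have h3 : (2^-1 : R) ^+ n <= 2^-1 ^+ k.
    by rewrite ler_wiXn2l ?leq_maxr// invf_le1// ler1n.
  have := dtri x (u (f n)) (u z.2); have := dsym x (u (f n)).
  lra.
have /choice[phi phiP] s : exists x,
    (good s -> forall z, A z s -> d x (u z.2) <= 2^-1 ^+ z.1) /\
    (~ good s -> x = x0).
  have [gs|ngs] := pselect (good s); last by exists x0.
  by have [x xP] := limit s gs; exists x.
have mG k : measurable (\bigcup_(z in [set z : nat * nat | z.1 == k]) A z).
  by case: (muA (fun z => z.1 == k)).
have goodE : good = @I01 R `&` \bigcap_k \bigcup_(z in [set z : nat * nat | z.1 == k]) A z.
  apply/seteqP; split => [s [s01 h]|s [s01 h]]; split => // k.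
    by move=> _; have [n sn] := h k; exists (k, n) => /=.
  by have [[a n] /= /eqP -> sA] := h k I; exists n.
have mgood : measurable good.
  rewrite goodE; apply: measurableI; first exact: measurable_I01.
  by apply: bigcapT_measurable => k; exact: mG.
have bad0 : lebesgue (@I01 R `\` good) = 0%E.
  have -> : @I01 R `\` good = \bigcup_k (@I01 R `\`
     \bigcup_(z in [set z : nat * nat | z.1 == k]) A z).
    rewrite goodE; apply/seteqP; split => [s [s01 h]|s [k _ [s01 h]]]; last first.
      by split => // -[_ /(_ k I)].
    have [k h'] : exists k, ~ (\bigcup_(z in [set z : nat * nat | z.1 == k]) A z) s.
      by apply: contra_notP h => /forallNP h; split=> // k _; apply: contrapT.
    by exists k.
  have mD k : measurable (@I01 R `\` \bigcup_(z in [set z : nat * nat | z.1 == k]) A z).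
    by apply: measurableD => //; exact: measurable_I01.
  apply: measure_negligible; first exact: bigcupT_measurable.
  apply: negligible_bigcup => k.
  suff h : lebesgue (@I01 R `\` \bigcup_(z in [set z : nat * nat | z.1 == k]) A z) = 0%E.
    exists (@I01 R `\` \bigcup_(z in [set z : nat * nat | z.1 == k]) A z).
    split. exact: mD. exact: h. exact: subset_refl.
  transitivity (1 - lebesgue (\bigcup_(z in [set z : nat * nat | z.1 == k]) A z))%E.
    by apply: lebesgue_I01D => // s [z _] /(proj2 (mA z)).
  have [_ ->] := muA (fun z => z.1 == k).
  rewrite (_ : \bigcup_(z in _) _ = setT).
    by have [_ _ _ ->] := mm_prob X; rewrite subee.
  apply/seteqP; split => // x _; have [n xn] := du x _ (e0 k).
  by exists (k, n) => //=; rewrite /mball/= dsym.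
have mbad : measurable (@I01 R `\` good) by apply: measurableD => //; exact: measurable_I01.
have [P PE] := mm_prob_exists X.
exists phi; apply: (@dynkin_induction _ (mmB X) (mopen d)) => //.
- by move=> U V oU oV; exact: mopenI.
- rewrite preimage_setT setIT; split; first exact: measurable_I01.
  by have [_ _ _ ->] := mm_prob X; rewrite I01_measure.
- move=> U oU.
  (* The doubled radius leaves room for [phi s], whose distance to the centre is only known to be at
     most the radius. *)
  pose q z := `[< mball d (u z.2) (2 * 2^-1 ^+ z.1) `<=` U >].
  have [mW muW] := muA q; set W := \bigcup_(z in _) _ in mW muW.
  have UE : \bigcup_(z in [set z | q z]) mball d (u z.2) (2^-1 ^+ z.1) = U.
    apply/seteqP; split => [x [z /asboolP zU xz]|x Ux].
      by apply: zU; rewrite /mball/= in xz *; have := e0 z.1; lra.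
    (* A third of [r]: one radius from [x] to the centre and two for the doubled ball. *)
    have [r r0 rU] := oU _ Ux; have [k kr] := half_pow_lt (divr_gt0 r0 (ltr0Sn R 2)).
    have [n xn] := du x _ (e0 k); exists (k, n); last by rewrite /mball/= dsym.
    apply/asboolP => y yn; apply: rU; rewrite /mball/= in yn *.
    by have := dtri x (u n) y; lra.
  have goodU : good `&` phi @^-1` U = good `&` W.
    apply/seteqP; split => s [gs sU]; split => //.
      have [r r0 rU] := oU _ sU; have [k kr] := half_pow_lt (divr_gt0 r0 (ltr0Sn R 2)).
      have [_ /(_ k)[n sn]] := gs; exists (k, n) => //.
      apply/asboolP => y yn; apply: rU; rewrite /mball/= in yn *.
      have /= := (proj1 (phiP s)) gs _ sn; have := dtri (phi s) (u n) y; lra.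
    have [z /asboolP zU sz] := sU; apply: zU; rewrite /mball/= dsym.
    have /= := (proj1 (phiP s)) gs _ sz; have := e0 z.1; lra.
  (* Off [good], [phi] is constantly [x0], so this preimage is the whole null set or empty, hence
     measurable. *)
  pose N := (@I01 R `\` good) `&` phi @^-1` U.
  have mN : measurable N.
    have [Ux|Ux] := pselect (U x0).
      rewrite /N setIidl// => s [_ ngs]; by rewrite /= (proj2 (phiP s) ngs).
    rewrite /N (_ : _ `&` _ = set0)//; apply/seteqP; split => // s [[_ ngs]].
    by rewrite /= (proj2 (phiP s) ngs).
  have IU : @I01 R `&` phi @^-1` U = (good `&` W) `|` N.
    rewrite -goodU /N; apply/seteqP; split => s.
      by move=> [s01 sU]; have [gs|gs] := pselect (good s); [left|right].
    by case=> [[[s01 _] sU]|[[s01 _] sU]]; split.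
  have N0 : lebesgue N = 0%E by apply: subset_measure0 bad0 => // s [].
  have mgW : measurable (good `&` W) by exact: measurableI.
  rewrite IU; split; first exact: measurableU.
  have W0 : lebesgue (W `\` good) = 0%E.
    apply: (subset_measure0 _ _ _ bad0) => //; first exact: measurableD.
    by move=> s [[z _ /(proj2 (mA z)) s01] gs].
  have WE : lebesgue W = (lebesgue (W `\` good) + lebesgue (W `&` good))%E.
    exact: measureDI.
  rewrite measureU0//; first by move: muW; rewrite UE WE W0 add0e setIC.
- move=> S mS [mphi muphi].
  have -> : @I01 R `&` phi @^-1` (~` S) = @I01 R `\` (@I01 R `&` phi @^-1` S).
    by apply/seteqP; split => s [s01 h]; split => // h'; apply: h => //; case: h'.
  split; first by apply: measurableD => //; exact: measurable_I01.
  rewrite lebesgue_I01D//.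
  rewrite muphi -!PE//; last exact: mborelC.
  by apply/esym/probability_setC.
- move=> F mF tF QF.
  have -> : @I01 R `&` phi @^-1` (\bigcup_k F k) = \bigcup_k (@I01 R `&` phi @^-1` F k).
    by rewrite preimage_bigcup setI_bigcupr.
  split; first by apply: bigcupT_measurable => n; case: (QF n).
  rewrite measure_bigcup//; last 2 first.
  + by move=> n _; case: (QF n).
  + move=> i j _ _ [s [[_ si] [_ sj]]]; apply: (tF i j) => //; by exists (phi s).
  rewrite -PE; last exact: (@bigcupT_measurable _ (mmB X)).
  rewrite measure_bigcup//.
  apply: eq_eseriesr => n _; transitivity (mm_mu (F n)); first by case: (QF n).
  exact: (esym (PE _ (mF n))).
Qed.

End Parametrization.

(** * Pyramids of finite spaces *)

Section Finite.
Context {R : realType}.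

Lemma fin_pos_lower_bound (F : finType) (f : F -> R) :
  (forall i, 0 < f i) -> exists2 e, 0 < e & forall i, e <= f i.
Proof.
move=> f0; suff [e e0 ef] : exists2 e, 0 < e & forall i, i \in enum F -> e <= f i.
  by exists e => // i; apply: ef; rewrite mem_enum.
elim: (enum F) => [|a s [e e0 IH]]; first by exists 1.
exists (Num.min e (f a)); first by rewrite lt_min e0 f0.
by move=> i /[!inE] /predU1P[->|/IH]; rewrite ge_min ?lexx ?orbT// => ->.
Qed.

Lemma metric_eq (T : Type) (d : T -> T -> R) x : is_metric d -> d x x = 0.
Proof. by move=> [_ /(_ x x) h _ _]; apply/h. Qed.

Lemma metric_gt0 (T : Type) (d : T -> T -> R) x y :
  is_metric d -> x <> y -> 0 < d x y.
Proof. by move=> [h0 /(_ x y) h _ _] xy; rewrite lt_def h0 andbT; apply/eqP => /h. Qed.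

Variables (I : finType) (w : I -> R).
Hypotheses (w0 : forall i, 0 < w i) (w1 : \sum_i w i = 1).

Definition push (T : Type) (p : I -> T) (B : set T) : R :=
  \sum_(i | `[< B (p i) >]) w i.

Lemma push_ge0 (T : Type) (p : I -> T) B : 0 <= push p B.
Proof. by apply: sumr_ge0 => i _; exact: ltW. Qed.

Lemma push_ge (T : Type) (p : I -> T) (B : set T) i : B (p i) -> w i <= push p B.
Proof.
move=> Bi; rewrite /push (bigD1 i)/=; last exact/asboolP.
by rewrite lerDl sumr_ge0// => j _; exact: ltW.
Qed.

Lemma push_setT (T : Type) (p : I -> T) : push p setT = 1.
Proof. by rewrite -w1; apply: eq_bigl => i; apply/asboolP. Qed.

Lemma push_set0 (T : Type) (p : I -> T) (B : set T) :
  (forall i, ~ B (p i)) -> push p B = 0.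
Proof. by move=> h; apply: big_pred0 => i; apply/asboolP. Qed.

Lemma push_U (T : Type) (p : I -> T) (A B : set T) : A `&` B = set0 ->
  push p (A `|` B) = push p A + push p B.
Proof.
move=> AB; rewrite /push !(big_mkcond (fun i => `[< _ >]))/= -big_split/=.
apply: eq_bigr => i _; rewrite asbool_or.
case: asboolP => hA; case: asboolP => hB; rewrite ?addr0 ?add0r//=.
by have : (A `&` B) (p i) by []; rewrite AB.
Qed.

Lemma fin_discrete (T : Type) (d : T -> T -> R) (p : I -> T) :
  is_metric d -> (forall x, exists i, x = p i) ->
  exists2 e, 0 < e & forall x y, d x y < e -> x = y.
Proof.
move=> md ps.
have [|e e0 eP] := @fin_pos_lower_bound (I * I)%type
    (fun z => if `[< p z.1 = p z.2 >] then 1 else d (p z.1) (p z.2)).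
  by move=> z; case: asboolP => // h; exact: metric_gt0.
exists e => // x y; have [i ->] := ps x; have [j ->] := ps y.
by have := eP (i, j) => /=; case: asboolP => // _ /le_lt_trans h /h; rewrite ltxx.
Qed.

Lemma fin_complete (T : Type) (d : T -> T -> R) (p : I -> T) :
  is_metric d -> (forall x, exists i, x = p i) -> complete_metric d.
Proof.
move=> md ps; have [e e0 eP] := fin_discrete md ps.
move=> u /(_ e e0)[N NP]; exists (u N) => r r0; exists N => n Nn.
by rewrite (eP (u n) (u N)) ?metric_eq//; exact: NP.
Qed.

Lemma index_inhabited : exists i : I, True.
Proof.
apply: contrapT => h; move: w1; rewrite big1 => [/eqP|i _].
  by rewrite eq_sym oner_eq0.
by exfalso; apply: h; exists i.
Qed.

Lemma fin_separable (T : Type) (d : T -> T -> R) (p : I -> T) :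
  is_metric d -> (forall x, exists i, x = p i) -> separable_metric d.
Proof.
move=> md ps; have [i0 _] := index_inhabited.
exists (fun n => p (nth i0 (enum I) n)) => x e e0; have [i ->] := ps x.
by exists (index i (enum I)); rewrite nth_index ?mem_enum// metric_eq.
Qed.

Lemma fin_probability (T : Type) (d : T -> T -> R) (p : I -> T) :
  borel_probability d (fun B => (push p B)%:E).
Proof.
split.
- by rewrite push_set0// => i.
- by move=> B _; rewrite lee_fin push_ge0.
- move=> F _ tF.
  (* [k i] locates [p i] among the sets [F n]; past the largest [k i] the partial sums are
     constant. *)
  have /choice[k kP] i : exists k, (\bigcup_n F n) (p i) -> F k (p i).
    have [[k _ h]|h] := pselect ((\bigcup_n F n) (p i)); first by exists k.
    by exists 0.
  have sumE n : (\sum_(0 <= i < n) (push p (F i))%:E)%E =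
                (push p (\bigcup_(i in `I_n) F i))%:E.
    elim: n => [|n IH]; first by rewrite big_geq// push_set0// => i [].
    rewrite big_nat_recr//= IH -EFinD -push_U.
      congr (push p _)%:E; apply/seteqP; split => x.
        by case=> [[i /= hi xi]|xn]; [exists i => //=; exact: ltnW|exists n => /=].
      move=> [i /=]; rewrite ltnS leq_eqVlt => /predU1P[->|hi] xi; first by right.
      by left; exists i.
    apply/seteqP; split => // x [[i /= ni xi] xn].
    by move: ni; rewrite (tF i n) ?ltnn//; exists x.
  apply: cvg_near_cst; exists (\max_i k i).+1 => // n /= nk; rewrite sumE.
  congr EFin; apply: eq_bigl => i; apply/asbool_equiv_eq; split=> [[j _ h]|/kP h].
    by exists j.
  by exists (k i) => //=; apply: leq_trans nk; rewrite ltnS leq_bigmax.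
- by rewrite push_setT.
Qed.

Lemma fin_full_support (T : Type) (d : T -> T -> R) (p : I -> T) :
  is_metric d -> (forall x, exists i, x = p i) ->
  forall x r, 0 < r -> (0 < (push p (mball d x r))%:E)%E.
Proof.
move=> md ps x r r0; have [i xi] := ps x; rewrite lte_fin.
by apply: (lt_le_trans (w0 i)); apply: push_ge; rewrite -xi; exact: mball_center.
Qed.

(** [p] may identify indices, whose weights then add up; all members of a finite pyramid have this
    form. *)
Definition fin_mm (T : Type) (d : T -> T -> R) (p : I -> T)
    (md : is_metric d) (ps : forall x, exists i, x = p i) : mmspace R :=
  MMSpace md (fin_complete md ps) (fin_separable md ps) (fin_probability d p)
    (fin_full_support md ps).

(* The mm-spaces dominated by the weighted point set [I] with distances [m],
   where [m] need not satisfy the triangle inequality and may take the value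
   +oo. *)
Definition fin_pyr (m : I -> I -> \bar R) : set (mmspace R) :=
  [set Y : mmspace R | exists p : I -> Y,
    (forall B, mborel (@mm_d R Y) B -> mm_mu B = (push p B)%:E) /\
    (forall i j, ((mm_d (p i) (p j))%:E <= m i j)%E)].

(** A point missed by [p] has positive distance to the finitely many [p i], so a small ball around
    it is null, against full support. *)
Lemma fin_pyr_onto (Y : mmspace R) (p : I -> Y) :
  (forall B, mborel (@mm_d R Y) B -> mm_mu B = (push p B)%:E) ->
  forall y, exists i, y = p i.
Proof.
move=> pY y; apply: contrapT => /forallNP h.
have md := mm_is_metric Y.
have [e e0 eP] := fin_pos_lower_bound (fun i => metric_gt0 md (h i)).
have := mm_full_support y e0; rewrite pY; last exact: mborel_mball.
rewrite push_set0 ?ltxx// => i; rewrite /mball/=; apply/negP.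
by rewrite -leNgt.
Qed.

Lemma fin_mm_in_fin_pyr (T : Type) (d : T -> T -> R) (p : I -> T)
    (md : is_metric d) (ps : forall x, exists i, x = p i) m :
  (forall i j, ((d (p i) (p j))%:E <= m i j)%E) -> fin_pyr m (fin_mm md ps).
Proof. by move=> h; exists p. Qed.

Lemma fin_pyr_nonempty m : (forall i j, (0 <= m i j)%E) ->
  exists Y, fin_pyr m Y.
Proof.
move=> m0; have [i0 _] := index_inhabited.
have md : is_metric (fun _ _ : unit => 0 : R).
  by split=> // [] []; rewrite ?addr0// => -[].
have ps (x : unit) : exists i : I, x = (fun=> tt) i by exists i0; case: x.
exists (fin_mm md ps); exact: fin_mm_in_fin_pyr.
Qed.

Lemma fin_pyr_down m X Y : fin_pyr m X -> dominated Y X -> fin_pyr m Y.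
Proof.
move=> [p [pX pm]] [f [f1 fY]]; exists (f \o p); split.
- move=> B mB; rewrite -fY// pX//.
  by apply: (@mborel_preimage _ _ _ _ _ _ 1) mB => // x y; rewrite mul1r.
- by move=> i j; apply: le_trans (pm i j); rewrite lee_fin f1.
Qed.

(** The upper bound is the set of pairs [(p i, p' i)] with the maximum metric: [m] bounds both
    coordinates, and the projections are 1-Lipschitz. *)
Lemma fin_pyr_directed m X X' : fin_pyr m X -> fin_pyr m X' ->
  exists2 Z, fin_pyr m Z & dominated X Z /\ dominated X' Z.
Proof.
move=> [p [pX pm]] [p' [pX' pm']].
pose T := {z : X * X' | exists i, z = (p i, p' i)}.
pose d (a b : T) := Num.max (mm_d (sval a).1 (sval b).1) (mm_d (sval a).2 (sval b).2).
have [a0 aeq asym atri] := mm_is_metric X.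
have [b0 beq bsym btri] := mm_is_metric X'.
have md : is_metric d.
  split.
  - by move=> x y; rewrite le_max a0.
  - move=> [[x x'] hx] [[y y'] hy]; rewrite /d/=; split => [h|[-> ->]]; last first.
      by rewrite (iffRL (aeq _ _))// (iffRL (beq _ _))// maxxx.
    suff E : (x, x') = (y, y') by apply: eq_exist.
    have := lexx (0 : R); rewrite -[X in X <= _]h ge_max => /andP[ha hb].
    congr (_, _); [apply/aeq|apply/beq]; apply/eqP; rewrite eq_le ?ha ?hb ?a0 ?b0//.
  - by move=> x y; rewrite /d asym bsym.
  - move=> x y z; rewrite /d ge_max; apply/andP; split.
      by apply: (le_trans (atri _ (sval y).1 _)); rewrite lerD// le_max lexx.
    by apply: (le_trans (btri _ (sval y).2 _)); rewrite lerD// le_max lexx orbT.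
pose q i : T := exist _ (p i, p' i) (ex_intro _ i erefl).
have qs x : exists i, x = q i.
  by case: x => z [i zi]; exists i; apply: eq_exist.
exists (fin_mm md qs).
  apply: fin_mm_in_fin_pyr => i j; rewrite /d EFin_max ge_max.
  by rewrite pm pm'.
split.
- exists (fun z : T => (sval z).1); split; first by move=> x y; rewrite le_max lexx.
  by move=> B mB; rewrite pX.
- exists (fun z : T => (sval z).2); split; first by move=> x y; rewrite le_max lexx orbT.
  by move=> B mB; rewrite pX'.
Qed.

Lemma fin_pyr_dilate m t X Y : 0 < t -> fin_pyr m X -> mm_dilate t X Y ->
  fin_pyr (fun i j => (t%:E * m i j)%E) Y.
Proof.
move=> t0 [p [pX pm]] [f [_ fd fY]]; exists (f \o p); split.
- move=> B mB; rewrite -fY// pX//.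
  by apply: (@mborel_preimage _ _ _ _ _ _ t) mB => // x y; rewrite fd.
- by move=> i j; rewrite fd EFinM lee_pmul2l.
Qed.

(** [Y] is finite, so the rescaled space can be rebuilt as a [fin_mm] on the same carrier. *)
Lemma fin_pyr_undilate m t Y : 0 < t -> fin_pyr (fun i j => (t%:E * m i j)%E) Y ->
  exists2 X, fin_pyr m X & mm_dilate t X Y.
Proof.
move=> t0 [p [pY pm]].
have [a0 aeq asym atri] := mm_is_metric Y.
have md : is_metric (fun x y : Y => t^-1 * mm_d x y).
  split.
  - by move=> x y; rewrite mulr_ge0// invr_ge0 ltW.
  - move=> x y; rewrite -aeq; split => [/eqP|->]; last by rewrite mulr0.
    by rewrite mulf_eq0 invr_eq0 gt_eqF//= => /eqP.
  - by move=> x y; rewrite asym.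
  - by move=> x y z; rewrite -mulrDr ler_pM2l ?invr_gt0.
have ps := fin_pyr_onto pY.
exists (fin_mm md ps).
  apply: fin_mm_in_fin_pyr => i j; rewrite EFinM.
  by rewrite -(@lee_pmul2l _ t%:E)//= -!EFinM mulrA divff ?gt_eqF// mul1r.
exists id; split; first by exists id.
- by move=> x y /=; rewrite mulrA divff ?gt_eqF// mul1r.
- by move=> B mB; rewrite pY.
Qed.

End Finite.

(** * Estimates for the box distance *)

Section Box.
Context {R : realType}.
Local Notation lebesgue := (@lebesgue_measure R).

Lemma box_adm_lb (X Y : mmspace R) : lbound (box_adm X Y) 0.
Proof. by move=> e []. Qed.

(* Without parametrizations the set of admissible values would be empty and the
   infimum the junk value [0]. *)
Lemma box_adm1 (X Y : mmspace R) : box_adm X Y 1.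
Proof.
have [phi hphi] := parametrization_exists X.
have [psi hpsi] := parametrization_exists Y.
split=> //; exists phi, psi, set0; split => //.
by rewrite subrr measure0.
Qed.

Lemma box_ge0 (X Y : mmspace R) : 0 <= box X Y.
Proof. by apply: lb_le_inf; [exists 1; exact: box_adm1|exact: box_adm_lb]. Qed.

Lemma box_self (X : mmspace R) : box X X = 0.
Proof.
apply/eqP; rewrite eq_le box_ge0 andbT; apply: ge_inf.
  by exists 0; exact: box_adm_lb.
have [phi hphi] := parametrization_exists X.
split=> //; exists phi, phi, (@I01 R); split => //; first exact: measurable_I01.
- by rewrite I01_measure subr0.
- by move=> s t _ _; rewrite subrr normr0.
Qed.

Lemma box_lt_adm (X Y : mmspace R) e : box X Y < e ->
  exists2 e', e' < e & box_adm X Y e'.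
Proof.
move=> h; have hb : has_inf (box_adm X Y).
  by split; [exists 1; exact: box_adm1|exists 0; exact: box_adm_lb].
have [e' adm e'e] := inf_adherent (ltac:(by rewrite subr_gt0) : 0 < e - box X Y) hb.
by exists e' => //; move: e'e; rewrite addrC subrK.
Qed.

Lemma boxP_ge (X : mmspace R) P e : P !=set0 ->
  (forall Y, P Y -> e <= box X Y) -> e <= boxP X P.
Proof.
move=> [Y PY] h; apply: lb_le_inf; first by exists (box X Y), Y.
by move=> _ [Z PZ <-]; exact: h.
Qed.

Lemma boxP_mem (X : mmspace R) P : P X -> boxP X P = 0.
Proof.
move=> PX; apply/eqP; rewrite eq_le; apply/andP; split; last first.
  by apply: boxP_ge => [|Y _]; [exists X|exact: box_ge0].
rewrite -(box_self X); apply: ge_inf; last by exists X.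
by exists 0 => _ [Z _ <-]; exact: box_ge0.
Qed.

Section LargeSet.
Variables (I0 : set R) (e : R).
Hypotheses (I0sub : I0 `<=` @I01 R) (mI0 : measurable I0)
  (I0large : ((1 - e)%:E <= lebesgue I0)%E).

Lemma large_compl : (lebesgue (@I01 R `\` I0) <= e%:E)%E.
Proof.
rewrite lebesgue_I01D//.
have : (lebesgue I0 < +oo)%E by exact: measure_I01_fin.
have : (0 <= lebesgue I0)%E by exact: measure_ge0.
move: I0large; case: (lebesgue I0) => // r.
by rewrite !lee_fin => h _ _; rewrite lerBlDr -lerBlDl.
Qed.

Lemma large_meet A : measurable A -> A `<=` @I01 R ->
  (e%:E < lebesgue A)%E -> exists2 s, A s & I0 s.
Proof.
move=> mA AI eA; apply: contrapT => h.
suff : (lebesgue A <= e%:E)%E by rewrite leNgt eA.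
apply: le_trans large_compl; apply: (@le_measure _ _ _ lebesgue); rewrite ?inE//.
  by apply: measurableD => //; exact: measurable_I01.
by move=> s As; split; [exact: AI|move=> I0s; apply: h; exists s].
Qed.

(** [A] is covered by [B] and the complement of [I0], whose measure is at most [e]. *)
Lemma large_le A B : measurable A -> measurable B -> A `<=` @I01 R ->
  A `&` I0 `<=` B -> (lebesgue A <= lebesgue B + e%:E)%E.
Proof.
move=> mA mB AI AB.
have mC : measurable (@I01 R `\` I0) by apply: measurableD => //; exact: measurable_I01.
have h : (lebesgue A <= lebesgue (B `|` (@I01 R `\` I0)))%E.
  apply: (@le_measure _ _ _ lebesgue); rewrite ?inE//; first exact: measurableU.
  move=> s As; have [I0s|nI0s] := pselect (I0 s); first by left; exact: AB.
  by right; split => //; exact: AI.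
apply: (le_trans h); apply: (@le_trans _ _ (lebesgue B + lebesgue (@I01 R `\` I0))%E).
  exact: measureU2.
by rewrite leeD2l// large_compl.
Qed.

End LargeSet.

End Box.

(** * Closedness of finite pyramids *)

Section Closed.
Context {R : realType} (I : finType) (w : I -> R).
Hypotheses (w0 : forall i, 0 < w i) (w1 : \sum_i w i = 1).
Local Notation lebesgue := (@lebesgue_measure R).
Local Notation fin_pyr := (fin_pyr w).
Local Notation push := (push w).

Lemma fin_mborel (X : mmspace R) (p : I -> X) (A : set X) :
  (forall x, exists i, x = p i) -> mborel (@mm_d R X) A.
Proof.
move=> ps; have [e e0 eP] := fin_discrete (mm_is_metric X) ps.
by apply: mopen_mborel => x Ax; exists e => // y /eP <-.
Qed.

Section Near.
Variables (m : I -> I -> \bar R) (Y : mmspace R).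
Hypothesis Ynear : forall e, 0 < e -> exists m' X,
  [/\ forall i j, (m' i j <= m i j + e%:E)%E, fin_pyr m' X & box Y X < e].
Local Notation d := (@mm_d R Y).

(** For [X] close enough to [Y], the set [I0] meets the preimage of a small ball around each [y i];
    the corresponding points of [X] are distinct, and [X] has at most [#|I|] points. *)
Lemma near_card n (y : 'I_n -> Y) : injective y -> (n <= #|I|)%N.
Proof.
move=> yinj; have md := mm_is_metric Y; have [d0 deq dsym dtri] := md.
have [|e e0 eP] := @fin_pos_lower_bound R ('I_n * 'I_n)%type
    (fun z => if z.1 == z.2 then 1 else d (y z.1) (y z.2)).
  by move=> z; case: eqP => // h; apply: metric_gt0 => // /yinj/h.
(* A third for each leg of the path [y i], [phi (s i)], [phi (s j)], [y j]. *)
pose dl := e / 3; have dl0 : 0 < dl by rewrite divr_gt0.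
have [mu_fin mu_pos] :
    (forall i, mm_mu (mball d (y i) dl) = (fine (mm_mu (mball d (y i) dl)))%:E)
   /\ forall i, 0 < fine (mm_mu (mball d (y i) dl)).
  have [P PE] := mm_prob_exists Y.
  have mb i : mborel d (mball d (y i) dl) by exact: mborel_mball.
  have fi i : (mm_mu (mball d (y i) dl) \is a fin_num)%E.
    by rewrite -(PE _ (mb i)); apply: fin_num_measure; exact: mb.
  split=> i; first by rewrite fineK.
  by rewrite fine_gt0// mm_full_support// ltey_eq fi.
have [r r0 rP] := fin_pos_lower_bound mu_pos.
have [|m' [X [_ [p [pX _]] bYX]]] := Ynear (e := Num.min r dl).
  by rewrite lt_min r0.
have ps := fin_pyr_onto pX.
have [e' e'lt [_ [phi [psi [I0 [[hphi hpsi] I0s mI0 I0l I0d]]]]]] := box_lt_adm bYX.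
move: e'lt; rewrite lt_min => /andP[e'r e'd].
have /choice[s sP] i : exists s, I0 s /\ d (y i) (phi s) < dl.
  have mb : mborel d (mball d (y i) dl) by exact: mborel_mball.
  have [mA muA] := hphi _ mb.
  have [||s [_ sb] sI] := @large_meet _ _ _ I0s mI0 I0l _ mA _ _; last by exists s.
    by move=> s [].
  by rewrite muA mu_fin lte_fin (lt_le_trans e'r).
have /choice[l lP] i : exists j, psi (s i) = p j by exact: ps.
rewrite -[n]card_ord; apply: (@leq_card _ _ l) => i j lij.
apply/eqP/negPn/negP => ij.
have := eP (i, j); rewrite /= (negbTE ij).
have [si hi] := sP i; have [sj hj] := sP j.
have := I0d _ _ si sj; rewrite lP lP lij metric_eq ?subr0; last exact: mm_is_metric.
rewrite ger0_norm// => h.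
have := dtri (y i) (phi (s i)) (y j); have := dtri (phi (s i)) (phi (s j)) (y j).
rewrite (dsym (phi (s j)) (y j)).
have : dl * 3 = e by rewrite divfK.
lra.
Qed.

Lemma near_fin : exists n (y : 'I_n -> Y), injective y /\ forall x, exists i, x = y i.
Proof.
pose P n := `[< exists y : 'I_n -> Y, injective y >].
have Pex : exists n, P n by exists 0; apply/asboolP;
    exists (fun i : 'I_0 => False_rect Y (elimF idP (erefl false) (ltn_ord i))) => -[].
have Pb n : P n -> (n <= #|I|)%N by move=> /asboolP[y]; exact: near_card.
have [n /asboolP[y yinj] nmax] := ex_maxnP Pex Pb.
exists n, y; split=> // x; apply: contrapT => /forallNP h.
suff : P n.+1 by move/nmax; rewrite ltnn.
(* A point missed by a largest injective family extends it, placed at the last index. *)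
apply/asboolP; exists (fun i => if unlift ord_max i is Some j then y j else x).
move=> i j; case: unliftP => [i' ->|->]; case: unliftP => [j' ->|->] //.
- by move=> /yinj ->.
- by move/esym/h.
- by move/h.
Qed.

(** For small [e] the relation between [psi t] and [phi t] for [t] in [I0] is a map defined on all
    of [X]; [g] is [p] followed by it. *)
Lemma near_map : exists2 e0, 0 < e0 & forall e, 0 < e < e0 ->
  exists g : I -> Y,
    (forall B, mborel d B -> (mm_mu B <= (push g B)%:E + e%:E)%E /\
                             ((push g B)%:E <= mm_mu B + e%:E)%E) /\
    (forall i j, ((d (g i) (g j))%:E <= m i j + (2 * e)%:E)%E).
Proof.
have md := mm_is_metric Y; have [d0 deq dsym dtri] := md.
have [n [y [_ ys]]] := near_fin.
have [dl dl0 dlP] := fin_discrete md ys.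
have [r r0 rP] := fin_pos_lower_bound w0.
(* Points of [Y] closer than [dl] coincide; no point of [X], of mass at least [r], can have its
   preimage avoid [I0]. *)
exists (Num.min dl r); first by rewrite lt_min dl0.
move=> e; rewrite lt_min => /and3P[e0 edl er].
have [m' [X [m'm [p [pX pm]] bYX]]] := Ynear e0.
have ps := fin_pyr_onto pX.
have [e' e'lt [e'0 [phi [psi [I0 [[hphi hpsi] I0s mI0 I0l I0d]]]]]] := box_lt_adm bYX.
have mX A : mborel (@mm_d R X) A by apply: fin_mborel ps.
have const s t : I0 s -> I0 t -> psi s = psi t -> phi s = phi t.
  move=> si ti st; apply: dlP; have := I0d s t si ti.
  rewrite st metric_eq ?subr0; last exact: mm_is_metric.
  by rewrite ger0_norm// => /le_lt_trans; apply; exact: lt_trans edl.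
have /choice[s sP] i : exists s, psi s = p i /\ I0 s.
  have [mA muA] := hpsi _ (mX [set p i]).
  have [||s [_ sb] sI] := @large_meet _ _ _ I0s mI0 I0l _ mA _ _; last by exists s.
    by move=> s [].
  rewrite muA pX// lte_fin (@lt_le_trans _ _ (w i))//; last exact: push_ge.
  by rewrite (lt_trans e'lt)// (lt_le_trans er).
exists (phi \o s); split.
  move=> B mB; have [mA muA] := hphi _ mB.
  (* The counterpart of [B] in [X]: for [t] in [I0], [phi t] is in [B] exactly when [psi t] is in
     [C]. *)
  pose C := [set x | exists i, x = p i /\ B (phi (s i))].
  have [mC muC] := hpsi _ (mX C).
  have CE : push p C = push (phi \o s) B.
    apply: eq_bigl => i; apply/asbool_equiv_eq; split => [[j [pij Bj]]|Bi].
      have [h1 h2] := sP i; have [h3 h4] := sP j.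
      by rewrite /= (const (s i) (s j))// h1 h3.
    by exists i.
  have BC t : I0 t -> B (phi t) <-> C (psi t).
    move=> It; have [i ti] := ps (psi t); have [h1 h2] := sP i; split=> h.
      by exists i; split=> //; rewrite (const (s i) t)// h1.
    have [j [tj Bj]] := h; have [h3 h4] := sP j.
    by rewrite (const t (s j))// h3.
  have e'e : (e'%:E <= e%:E)%E by rewrite lee_fin ltW.
  rewrite -CE -pX// -muC -muA; split.
    apply: (@le_trans _ _ (lebesgue (@I01 R `&` psi @^-1` C) + e'%:E)%E); last exact: leeD2l.
    apply: (large_le I0s) => //.
    by move=> t [[t01 Bt] It]; split => //; apply/BC.
  apply: (@le_trans _ _ (lebesgue (@I01 R `&` phi @^-1` B) + e'%:E)%E); last exact: leeD2l.
  apply: (large_le I0s) => //.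
  by move=> t [[t01 Bt] It]; split => //; apply/BC.
move=> i j; have [h1 h2] := sP i; have [h3 h4] := sP j.
have := I0d _ _ h2 h4; rewrite h1 h3 ler_norml => /andP[_].
rewrite lerBlDr => hd.
(* One [e] pays for the distortion on [I0], the other for the slack of [m'] over [m]. *)
apply: (@le_trans _ _ ((mm_d (p i) (p j))%:E + e%:E)%E).
  by rewrite -EFinD lee_fin (le_trans hd)// addrC lerD2l ltW.
apply: (@le_trans _ _ (m' i j + e%:E)%E); first exact: leeD2r.
apply: (@le_trans _ _ (m i j + e%:E + e%:E)%E); first exact: leeD2r.
by rewrite -addeA -EFinD -mulr2n mulr_natl.
Qed.

(* [Y] is finite, so one and the same map works for arbitrarily small [e], hence
   exactly. *)
Lemma near_fin_pyr : fin_pyr m Y.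
Proof.
have [n [y [_ ys]]] := near_fin.
have [e0 e00 He] := near_map.
pose Q (h : {ffun I -> 'I_n}) e :=
  (forall B, mborel d B -> (mm_mu B <= (push (y \o h) B)%:E + e%:E)%E /\
                           ((push (y \o h) B)%:E <= mm_mu B + e%:E)%E) /\
  (forall i j, ((d (y (h i)) (y (h j)))%:E <= m i j + (2 * e)%:E)%E).
have Qmono h e e' : e <= e' -> Q h e -> Q h e'.
  move=> ee' [Q1 Q2]; split.
    move=> B mB; have [h1 h2] := Q1 B mB; split.
      by apply: (le_trans h1); rewrite leeD2l// lee_fin.
    by apply: (le_trans h2); rewrite leeD2l// lee_fin.
  by move=> i j; apply: (le_trans (Q2 i j)); rewrite leeD2l// lee_fin ler_pM2l.
have [h hQ] : exists h, forall e, 0 < e -> Q h e.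
  apply: contrapT => /forallNP no.
  have /choice[f fP] h : exists e, 0 < e /\ ~ Q h e.
    by have /existsNP[e /not_implyP[? ?]] := no h; exists e.
  (* If each of the finitely many maps [h] failed at some [f h], one that is good at a value below
     all of them would contradict [Qmono]. *)
  have [r r0 rP] := fin_pos_lower_bound (fun h => proj1 (fP h)).
  have [|g [g1 g2]] := He (Num.min r (e0 / 2)).
    rewrite lt_min r0 divr_gt0//= gt_min; apply/orP; right.
    by rewrite ltr_pdivrMr// mulr_natr mulr2n ltrDl.
  have /choice[k kP] i := ys (g i).
  pose h := [ffun i => k i].
  have gE : g = y \o h by apply/funext => i /=; rewrite ffunE kP.
  apply: (proj2 (fP h)); apply: (Qmono _ (Num.min r (e0 / 2))).
    by rewrite ge_min rP.
  by rewrite gE in g1 g2.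
exists (y \o h); split.
  move=> B mB; apply/eqP; rewrite eq_le; apply/andP; split.
    by apply/lee_addgt0Pr => e /hQ[/(_ B mB)[]].
  by apply/lee_addgt0Pr => e /hQ[/(_ B mB)[]].
move=> i j; apply/lee_addgt0Pr => e eP.
have [|_ /(_ i j)] := hQ (e / 2); first by rewrite divr_gt0.
by rewrite mulrCA divff// mulr1.
Qed.

End Near.

(** Letting [m'] exceed [m] by [e] makes the gap uniform over nearby pyramids: the one bound yields
    closedness, with [m'] equal to [m], and the lower-limit half of weak convergence. *)
Lemma fin_pyr_far m Y : ~ fin_pyr m Y -> exists2 e, 0 < e &
  forall m' X, (forall i j, (m' i j <= m i j + e%:E)%E) -> fin_pyr m' X -> e <= box Y X.
Proof.
move=> nY; apply: contrapT => h; apply: nY; apply: near_fin_pyr => e e0.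
apply: contrapT => h'; apply: h; exists e => // m' X m'm mX.
by rewrite leNgt; apply/negP => bYX; apply: h'; exists m', X.
Qed.

Lemma fin_pyr_closed m : box_closed (fin_pyr m).
Proof.
move=> Y h; apply: contrapT => /fin_pyr_far[e e0 eP].
have [X mX] := h _ e0; rewrite ltNge (eP _ _ _ mX)//.
by move=> i j; rewrite leeDl// lee_fin ltW.
Qed.

Lemma fin_pyr_pyramid m : (forall i j, (0 <= m i j)%E) -> is_pyramid (fin_pyr m).
Proof.
move=> m0; split.
- exact: fin_pyr_nonempty.
- exact: fin_pyr_closed.
- by move=> X Y; exact: fin_pyr_down.
- by move=> X X'; exact: fin_pyr_directed.
Qed.

End Closed.

(** * Sequential topology of the space of pyramids *)

Section Sequential.
Context {R : realType}.
Implicit Types (P Q : pyramid R) (x y z : nat -> pyramid R).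

Lemma limn_einf_ge (u : nat -> R) (c : R) N : (forall n, (N <= n)%N -> c <= u n) ->
  (c%:E <= limn_einf (fun n => (u n)%:E))%E.
Proof.
move=> h; rewrite limn_einf_lim (cvg_lim _ (@cvg_einfs_sup _ _))//.
apply: (@le_trans _ _ (einfs (fun n => (u n)%:E) N)).
  2: by apply: ereal_sup_ubound; exists N.
by apply: le_ereal_inf_tmp => _ [n /= Nn <-]; rewrite lee_fin h.
Qed.

Lemma limn_einf_gt0 (u : nat -> R) : (0 < limn_einf (fun n => (u n)%:E))%E ->
  exists c N, 0 < c /\ forall n, (N <= n)%N -> c <= u n.
Proof.
rewrite limn_einf_lim (cvg_lim _ (@cvg_einfs_sup _ _))// => /ereal_sup_gt[_ [N _ <-]] h.
have hN n : (N <= n)%N -> (einfs (fun n => (u n)%:E) N <= (u n)%:E)%E.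
  by move=> Nn; apply: ereal_inf_lbound; exists n.
move: h hN; case: (einfs _ N) => [c| |] // => [c0 hN|_ /(_ N (leqnn N))] //.
by exists c, N; split => // n /hN; rewrite lee_fin.
Qed.

Lemma pyramid_eq P Q : (forall X, sval P X <-> sval Q X) -> P = Q.
Proof.
case: P Q => [P hP] [Q hQ] /= h; apply: eq_exist.
by apply/funext => X; apply/propext.
Qed.

Lemma pconv_unique x P Q : pconv x P -> pconv x Q -> P = Q.
Proof.
have sub A B : pconv x A -> pconv x B -> forall X, sval A X -> sval B X.
  move=> [cA _] [_ cB] X AX; apply: contrapT => /cB/limn_einf_gt0[c [N [c0 hc]]].
  have /cvgrPdist_lt /(_ c c0)[M _ hM] := cA X AX.
  have := hM (maxn N M) (leq_maxr _ _); have := hc (maxn N M) (leq_maxl _ _).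
  rewrite sub0r normrN => h; rewrite ltNge => /negP; apply.
  exact: le_trans (ler_norm _).
by move=> hP hQ; apply: pyramid_eq => X; split; exact: sub.
Qed.

(** Subsequences are encoded by any [s] with [n <= s n], not necessarily increasing: this is what
    [choice] delivers, and it suffices for limits. *)
Lemma pconv_subseq x P (s : nat -> nat) : (forall n, (n <= s n)%N) ->
  pconv x P -> pconv (x \o s) P.
Proof.
move=> sn [h1 h2]; split=> X PX.
  have := h1 X PX; move/cvgrPdist_lt => h; apply/cvgrPdist_lt => e /h[N _ hN].
  by exists N => // n Nn; apply: hN => /=; exact: leq_trans (sn n).
have [c [N [c0 hc]]] := limn_einf_gt0 (h2 X PX).
apply: (@lt_le_trans _ _ c%:E); first by rewrite lte_fin.
by apply: (@limn_einf_ge _ _ N) => n Nn; apply: hc; exact: leq_trans (sn n).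
Qed.

Lemma pconv_cst P : pconv (fun=> P) P.
Proof.
have [[Y PY] cl _ _] := svalP P.
split=> X PX.
  rewrite (_ : (fun _ => _) = fun=> 0); first exact: cvg_cst.
  by apply/funext => _; rewrite boxP_mem.
have [e [e0 he]] : exists e, 0 < e /\ forall Z, sval P Z -> e <= box X Z.
  apply: contrapT => /forallNP h; apply: PX; apply: cl => e e0.
  apply: contrapT => h'; apply: (h e); split=> // Z PZ.
  by rewrite leNgt; apply/negP => XZ; apply: h'; exists Z.
apply: (@lt_le_trans _ _ e%:E); first by rewrite lte_fin.
by apply: (@limn_einf_ge _ _ 0) => n _; apply: boxP_ge => //; exists Y.
Qed.

(** Write [y n] as [z (k n)]. If [k] is large at arbitrarily late places, a subsequence of [z]
    converges to [P]; otherwise [k] is eventually bounded, takes some value infinitely often, and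
    [P] is that term. *)
Lemma pconv_range z y P : (forall n, range z (y n)) -> pconv y P ->
  range z P \/ exists2 s : nat -> nat, (forall n, (n <= s n)%N) & pconv (z \o s) P.
Proof.
move=> hy yP.
have /choice[k yk] n : exists k, y n = z k by have [k _ <-] := hy n; exists k.
have [h|/existsNP[n0 h]] :=
    pselect (forall n, exists j, (n <= j)%N /\ (n <= k j)%N).
  right; have [s hs] := choice h; exists (k \o s); first by move=> n; case: (hs n).
  have -> : z \o (k \o s) = y \o s by apply/funext => n; rewrite /= yk.
  by apply: pconv_subseq => // n; case: (hs n).
left; have small j : (n0 <= j)%N -> (k j < n0)%N.
  by move=> nj; rewrite ltnNge; apply/negP => kj; apply: h; exists j.
have [v hv] : exists v, forall N, exists j, (N <= j)%N /\ k j = v.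
  apply: contrapT => /forallNP no.
  have /choice[N hN] (v : 'I_n0) : exists N, forall j, (N <= j)%N -> k j <> v.
    by have /existsNP[N hN] := no v; exists N => j Nj kj; apply: hN; exists j.
  pose j := maxn n0 (\max_v N v).
  have kj := small j (leq_maxl _ _).
  apply: (hN (Ordinal kj) j) => //.
  by apply: leq_trans (leq_maxr _ _); exact: (leq_bigmax (Ordinal kj)).
have [s hs] := choice hv; exists v => //.
apply: (@pconv_unique (y \o s)); last first.
  by apply: pconv_subseq => // n; case: (hs n).
have -> : y \o s = fun=> z v by apply/funext => n; rewrite /= yk; case: (hs n) => _ ->.
exact: pconv_cst.
Qed.

Definition tends x P := forall U, pyr_open U -> U P ->
  exists N, forall n, (N <= n)%N -> U (x n).

Lemma tends_subseq x P (s : nat -> nat) : (forall n, (n <= s n)%N) ->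
  tends x P -> tends (x \o s) P.
Proof.
move=> sn h U oU UP; have [N hN] := h U oU UP; exists N => n Nn.
by apply: hN; exact: leq_trans (sn n).
Qed.

Lemma pconv_tends x P : pconv x P -> tends x P.
Proof.
move=> xP U oU UP; apply: contrapT => /forallNP h.
have /choice[s hs] N : exists n, (N <= n)%N /\ (~` U) (x n).
  by have /existsNP[n /not_implyP[? ?]] := h N; exists n.
apply: (oU (x \o s) P) UP; first by move=> n; case: (hs n).
by apply: pconv_subseq => // n; case: (hs n).
Qed.

(* Converse of [pconv_tends] up to subsequences: otherwise the terms of the
   sequence, together with one sublimit if there is any, form a sequentially
   closed set missing [P]. *)
Lemma tends_pconv_subseq x P : tends x P ->
  exists2 s : nat -> nat, (forall n, (n <= s n)%N) & pconv (x \o s) P.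
Proof.
move=> xP; apply: contrapT => no.
(* Otherwise a subsequence constantly equal to [P] would converge to [P]. *)
have [N0 hN0] : exists N0, forall n, (N0 <= n)%N -> x n <> P.
  apply: contrapT => /forallNP h.
  have /choice[s hs] N : exists n, (N <= n)%N /\ x n = P.
    by have /existsNP[n /not_implyP[? /contrapT ?]] := h N; exists n.
  apply: no; exists s; first by move=> n; case: (hs n).
  rewrite (_ : x \o s = fun=> P); first exact: pconv_cst.
  by apply/funext => n; case: (hs n).
pose x' := x \o addn^~ N0.
have x'P : tends x' P by apply: tends_subseq => // n; exact: leq_addr.
have x'n n : x' n <> P by apply: hN0; exact: leq_addl.
have no' s : (forall n, (n <= s n)%N) -> ~ pconv (x' \o s) P.
  move=> sn h; apply: no; exists (addn^~ N0 \o s) => // n /=.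
  by apply: leq_trans (sn n) _; exact: leq_addr.
have refute (S : set (pyramid R)) : pyr_closed S -> ~ S P ->
    ~ (forall N, exists n, (N <= n)%N /\ S (x' n)).
  move=> cS SP h; have [||N hN] := x'P (~` S) => //.
    by rewrite /pyr_open setCK.
  by have [n [/hN]] := h N.
have [[s sn [Q sQ]]|no2] := pselect (exists2 s : nat -> nat,
    (forall n, (n <= s n)%N) & exists Q, pconv (x' \o s) Q).
  (* With the sublimit at index 0 the range is sequentially closed: every convergent subsequence of
     [z] tends to [Q], which differs from [P]. *)
  pose z n := if n is m.+1 then x' (s m) else Q.
  apply: (refute (range z)).
  - move=> y c hy yc; have [//|[t tn tc]] := pconv_range hy yc.
    have -> : c = Q; last by exists 0.
    (* The shift avoids the term [z 0]: [t n.+1] is at least [n.+1], hence a successor. *)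
    apply: (@pconv_unique (z \o t \o S)); first exact: pconv_subseq.
    have -> : z \o t \o S = (x' \o s) \o (fun n => (t n.+1).-1).
      by apply/funext => n /=; have := tn n.+1; case: (t n.+1).
    by apply: pconv_subseq => // n; have := tn n.+1; case: (t n.+1).
  - case=> -[_ /= QP|n _ /=]; last exact: x'n.
    by apply: (no' s) => //; rewrite -QP.
  - by move=> N; exists (s N); split=> //; exists N.+1.
(* Without any convergent subsequence the range alone is sequentially closed. *)
apply: (refute (range x')).
- move=> y c hy yc; have [//|[t tn tc]] := pconv_range hy yc.
  by exfalso; apply: no2; exists t => //; exists c.
- by case=> n _; exact: x'n.
- by move=> N; exists N; split=> //; exists N.
Qed.

(** Extracting for [P], and then for [Q] within that subsequence, gives one sequence converging
    weakly to both. *)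
Lemma tends_unique x P Q : tends x P -> tends x Q -> P = Q.
Proof.
move=> /tends_pconv_subseq[s sn sP] /(tends_subseq sn)/tends_pconv_subseq[t tn tQ].
by apply: pconv_unique tQ; exact: pconv_subseq.
Qed.

End Sequential.

(** * Three-point pyramids at two scales *)

Section ThreePoints.
Context {R : realType}.

Definition third (i : 'I_3) : R := 3^-1.

Lemma third_gt0 i : 0 < third i.
Proof. by rewrite invr_gt0. Qed.

Lemma third_sum : \sum_i third i = 1.
Proof. by rewrite /third sumr_const card_ord -[LHS]mulr_natl divff. Qed.

(* Points [0] and [1] at distance [a], both at distance [b] from the point [2].
   *)
Definition two_scales (a b : \bar R) (i j : 'I_3) : \bar R :=
  if (i == ord_max) == (j == ord_max) then a else b.

Lemma two_scales_ge0 a b : (0 <= a)%E -> (0 <= b)%E ->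
  forall i j, (0 <= two_scales a b i j)%E.
Proof. by move=> a0 b0 i j; rewrite /two_scales; case: ifP. Qed.

(** The diagonal value [a] of [two_scales] is harmless for nonnegative [a], since [fin_pyr] imposes
    upper bounds only. *)
Definition pyr3_set a b := fin_pyr third (two_scales a b).

Definition pyr3 a b (a0 : (0 <= a)%E) (b0 : (0 <= b)%E) : pyramid R :=
  exist _ (pyr3_set a b)
    (fin_pyr_pyramid third_gt0 third_sum (two_scales_ge0 a0 b0)).

Lemma pyr3_scale t a b a0 b0 (Q : pyramid R) : 0 < t ->
  pyr_scale_eq t (@pyr3 a b a0 b0) Q <->
  forall Y, sval Q Y <-> pyr3_set (t%:E * a) (t%:E * b) Y.
Proof.
move=> t0; have E : two_scales (t%:E * a) (t%:E * b) =
    fun i j => (t%:E * two_scales a b i j)%E.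
  by apply/funext => i; apply/funext => j; rewrite /two_scales; case: ifP.
have H Y : (exists2 X, pyr3_set a b X & mm_dilate t X Y) <->
    pyr3_set (t%:E * a) (t%:E * b) Y.
  rewrite /pyr3_set E; split=> [[X mX]|]; first exact: fin_pyr_dilate.
  exact: fin_pyr_undilate third_gt0 third_sum _ _ _ t0.
by split=> h Y; rewrite h -?H// H.
Qed.

Section Discrete.
Variables (T : Type) (r : R) (p : 'I_3 -> T).
Hypotheses (r0 : 0 < r) (ps : forall x, exists i, x = p i).

Definition discrete_dist (x y : T) : R := if `[< x = y >] then 0 else r.

Lemma discrete_metric : is_metric discrete_dist.
Proof.
rewrite /discrete_dist; split.
- by move=> x y; case: asboolP => // _; exact: ltW.
- move=> x y; case: asboolP => [//|xy]; split=> // /eqP.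
  by rewrite gt_eqF.
- by move=> x y; congr (if _ then _ else _); apply/asbool_equiv_eq; split.
- move=> x y z; case: (asboolP (x = z)) => [_|xz].
    by case: asboolP => _; case: asboolP => _; rewrite ?addr0 ?add0r// ?addr_ge0// ltW.
  case: (asboolP (x = y)) => [<-|_]; first by rewrite asboolF// add0r.
  by rewrite lerDl; case: asboolP => // _; exact: ltW.
Qed.

Definition discrete_mm : mmspace R :=
  fin_mm third_gt0 third_sum discrete_metric ps.

Lemma discrete_mm_mem a b : (0 <= a)%E -> (0 <= b)%E ->
  (forall i j, p i <> p j -> (r%:E <= two_scales a b i j)%E) ->
  pyr3_set a b discrete_mm.
Proof.
move=> a0 b0 h; apply: fin_mm_in_fin_pyr => i j; rewrite /discrete_dist.
by case: asboolP => [_|/h//]; exact: two_scales_ge0.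
Qed.

Lemma discrete_mm_dist a b : pyr3_set a b discrete_mm ->
  exists q : 'I_3 -> T, (forall x, exists i, x = q i) /\
    forall i j, q i <> q j -> (r%:E <= two_scales a b i j)%E.
Proof.
move=> [q [qX qm]]; exists q; split; first exact: (fin_pyr_onto qX).
by move=> i j qij; have := qm i j; rewrite /= /discrete_dist asboolF.
Qed.

End Discrete.

Lemma ismax_onto (x : bool) : exists i : 'I_3, x = (i == ord_max).
Proof. by case: x; [exists ord_max|exists ord0]. Qed.

(* [option bool] rather than ['I_3]: the universe of ['I_3] is too large for the
   carrier of an [mmspace]. *)
Definition label3 (i : 'I_3) : option bool :=
  if i == ord0 then None else Some (i == ord_max).

Lemma label3_onto (x : option bool) : exists i, x = label3 i.
Proof. by case: x => [[]|]; [exists ord_max|exists (inord 1)|exists ord0];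
  rewrite /label3 -?val_eqE /= ?inordK. Qed.

(** Test spaces: [two_point] probes the largest distance of a three-point pyramid, [three_point] the
    short distance [a]. *)
Definition two_point r (r0 : 0 < r) := discrete_mm r0 ismax_onto.

Definition three_point r (r0 : 0 < r) := discrete_mm r0 label3_onto.

Lemma two_point_mem r (r0 : 0 < r) a b : (0 <= a)%E -> (r%:E <= b)%E ->
  pyr3_set a b (two_point r0).
Proof.
move=> a0 rb; apply: discrete_mm_mem => //.
  by apply: le_trans rb; rewrite lee_fin ltW.
by move=> i j /eqP ij; rewrite /two_scales (negbTE ij).
Qed.

Lemma two_point_le r (r0 : 0 < r) a b : pyr3_set a b (two_point r0) ->
  (r%:E <= maxe a b)%E.
Proof.
move=> /discrete_mm_dist[q [qs qd]].
have [i ti] := qs true; have [j fj] := qs false.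
have := qd i j; rewrite -ti -fj => /(_ ltac:(by [])) /le_trans; apply.
by rewrite /two_scales le_max; case: ifP; rewrite lexx ?orbT.
Qed.

Lemma three_point_mem r (r0 : 0 < r) a b : (r%:E <= a)%E -> (r%:E <= b)%E ->
  pyr3_set a b (three_point r0).
Proof.
have h (c : \bar R) : (r%:E <= c)%E -> (0 <= c)%E.
  by apply: le_trans; rewrite lee_fin ltW.
move=> ra rb; apply: discrete_mm_mem; [exact: h|exact: h|].
by move=> i j ij; rewrite /two_scales; case: ifP.
Qed.

(** A labelling of three points by three indices is injective once onto, so indices 0 and 1 carry
    points at distance [r]. *)
Lemma three_point_le r (r0 : 0 < r) a b : pyr3_set a b (three_point r0) ->
  (r%:E <= a)%E.
Proof.
move=> /discrete_mm_dist[q [qs qd]].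
have qinj : injective q.
  have /choice[s sq] x : exists i, q i = x by have [i ->] := qs x; exists i.
  have sinj : injective s by apply: can_inj sq.
  have [|s' _ s'K] := inj_card_bij sinj; first by rewrite card_ord card_option card_bool.
  by apply: (can_inj (g := s)) => i; rewrite -(s'K i) sq.
have := qd (inord 0) (inord 1); rewrite /two_scales -!val_eqE /= !inordK//=; apply.
by move/qinj/(congr1 val); rewrite /= !inordK.
Qed.

Lemma pyr3_not_fixed a b a0 b0 : 0 < b -> a <= b ->
  ~ pyr_fixed (@pyr3 a%:E b%:E a0 b0).
Proof.
move=> bp ab /(_ 2 (ltr0Sn _ 1)) /pyr3_scale -/(_ (ltr0Sn _ 1)) h.
have b2 : 0 < 2 * b by rewrite mulr_gt0.
have /h/two_point_le : pyr3_set (2%:E * a%:E) (2%:E * b%:E) (two_point b2).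
  by apply: two_point_mem; [exact: mule_ge0|rewrite EFinM].
by rewrite -EFin_max lee_fin max_r// leNgt ltr_pMl// ltr1n.
Qed.

(** Rescaling leaves the far distance [+oo] unchanged, so doubling is detected on the short
    distance. *)
Lemma pyr3_oo_not_fixed a a0 b0 : 0 < a ->
  ~ pyr_fixed (@pyr3 a%:E +oo%E a0 b0).
Proof.
move=> ap /(_ 2 (ltr0Sn _ 1)) /pyr3_scale -/(_ (ltr0Sn _ 1)) h.
have a2 : 0 < 2 * a by rewrite mulr_gt0.
have /h/three_point_le : pyr3_set (2%:E * a%:E) (2%:E * +oo) (three_point a2).
  by apply: three_point_mem; rewrite ?EFinM// mulry gtr0_sg// mul1e leey.
by rewrite lee_fin leNgt ltr_pMl// ltr1n.
Qed.

Definition pyr3_star a b a0 b0 nf : pyr_star R :=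
  exist _ (@pyr3 a b a0 b0) nf.

Lemma orbit_pyr3 a b a0 b0 nf (Q : pyr_star R) :
  Defs.orbit (@pyr3_star a b a0 b0 nf) Q <->
  exists2 t, 0 < t & forall Y, sval (sval Q) Y <-> pyr3_set (t%:E * a) (t%:E * b) Y.
Proof.
split=> -[t t0 h]; exists t => //.
  exact: (iffLR (@pyr3_scale t a b a0 b0 (sval Q) t0)).
exact: (iffRL (@pyr3_scale t a b a0 b0 (sval Q) t0)).
Qed.

Lemma quot_proj_eq (P Q : pyr_star R) :
  quot_proj P = quot_proj Q <-> Defs.orbit P = Defs.orbit Q.
Proof. by split=> [[]//|h]; exact: eq_exist. Qed.

Lemma orbit_pyr3_scale s a b a0 b0 nf c d c0 d0 nf' : 0 < s ->
  c = (s%:E * a)%E -> d = (s%:E * b)%E ->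
  Defs.orbit (@pyr3_star a b a0 b0 nf) = Defs.orbit (@pyr3_star c d c0 d0 nf').
Proof.
move=> s0 cE dE; apply/seteqP; split => Q /orbit_pyr3[t t0 h]; apply/orbit_pyr3.
  exists (t / s); first exact: divr_gt0.
  by move=> Y; rewrite h cE dE !muleA -EFinM divfK ?gt_eqF.
exists (t * s); first exact: mulr_gt0.
by move=> Y; rewrite h cE dE !muleA -EFinM.
Qed.

(** An infinite far distance admits two-point spaces of every size, whereas the other pyramid
    rescaled by [t] allows no distance above [t * b]. *)
Lemma orbit_pyr3_neq a a0 d0 nf (b c : R) b0 c0 nf' : c <= b ->
  Defs.orbit (@pyr3_star a +oo%E a0 d0 nf) <> Defs.orbit (@pyr3_star c%:E b%:E c0 b0 nf').
Proof.
move=> cb e; set P := pyr3_star nf in e.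
have : Defs.orbit P P.
  apply/orbit_pyr3; exists 1 => // Y; by rewrite !mul1e.
rewrite e => /orbit_pyr3[t t0 h].
have r0 : 0 < t * b + 1.
  by rewrite ltr_wpDl// mulr_ge0 ?(ltW t0)// -lee_fin.
have /h/two_point_le : sval (sval P) (two_point r0).
  by apply: two_point_mem => //; exact: leey.
rewrite -!EFinM -EFin_max max_r ?ler_pM2l// lee_fin.
by rewrite gerDl ler10.
Qed.

Lemma two_scales_le a b c d i j : (a <= c)%E -> (b <= d)%E ->
  (two_scales a b i j <= two_scales c d i j)%E.
Proof. by rewrite /two_scales; case: ifP. Qed.

Lemma pyr3_set_le a b c d X : (a <= c)%E -> (b <= d)%E ->
  pyr3_set a b X -> pyr3_set c d X.
Proof.
move=> ac bd [p [pX pm]]; exists p; split=> // i j.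
by apply: (le_trans (pm i j)); exact: two_scales_le.
Qed.

(** Members have finite diameter, so the pyramid with far distance [+oo] is just the increasing
    union of those with finite [b]. *)
Lemma pyr3_set_finite a X : pyr3_set a +oo%E X ->
  exists b : R, pyr3_set a b%:E X.
Proof.
move=> [p [pX pm]]; exists (\sum_i \sum_j mm_d (p i) (p j)), p; split=> // i j.
have := pm i j; rewrite /two_scales; case: ifP => // _ _.
have [d0 _ _ _] := mm_is_metric X.
rewrite lee_fin (bigD1 i)//= (bigD1 j)//= -addrA lerDl addr_ge0 ?sumr_ge0// => k _.
by rewrite sumr_ge0.
Qed.

(** All approximants lie in the limit, so a space outside it stays uniformly away from them; a space
    in the limit is eventually a member. *)
Lemma pyr3_cvg_oo (a : \bar R) (b : nat -> R) a0 b0 oo0 :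
  (forall c, exists N, forall n, (N <= n)%N -> c <= b n) ->
  pconv (fun n => @pyr3 a (b n)%:E a0 (b0 n)) (@pyr3 a +oo%E a0 oo0).
Proof.
move=> boo; split=> X /= hX.
  have [c hc] := pyr3_set_finite hX; have [N hN] := boo c.
  apply: cvg_near_cst; exists N => // n /= Nn.
  by apply: boxP_mem; apply: pyr3_set_le hc => //; rewrite lee_fin hN.
have [e e0 eP] := fin_pyr_far third_gt0 hX.
apply: (@lt_le_trans _ _ e%:E); first by rewrite lte_fin.
apply: (@limn_einf_ge _ _ _ 0) => n _; apply: boxP_ge => [|Y hY].
  exact: (fin_pyr_nonempty third_gt0 third_sum (two_scales_ge0 a0 (b0 n))).
apply: eP hY => i j; apply: (@le_trans _ _ (two_scales a +oo i j)).
  by apply: two_scales_le => //; exact: leey.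
by rewrite leeDl// lee_fin ltW.
Qed.

(** Here the approximants contain the limit; a space outside it is kept away by [fin_pyr_far], with
    [a n] within the slack. *)
Lemma pyr3_cvg_0 (a : nat -> R) (b : \bar R) a0 b0 z0 :
  a @ \oo --> 0 ->
  pconv (fun n => @pyr3 (a n)%:E b (a0 n) b0) (@pyr3 0%E b z0 b0).
Proof.
move=> a_0; split=> X /= hX.
  apply: cvg_near_cst; exists 0 => // n _ /=.
  by apply: boxP_mem; apply: pyr3_set_le hX.
have [e e0 eP] := fin_pyr_far third_gt0 hX.
apply: (@lt_le_trans _ _ e%:E); first by rewrite lte_fin.
have /cvgrPdist_lt /(_ e e0)[N _ hN] := a_0.
apply: (@limn_einf_ge _ _ _ N) => n Nn; apply: boxP_ge => [|Y hY].
  exact: (fin_pyr_nonempty third_gt0 third_sum (two_scales_ge0 (a0 n) b0)).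
apply: eP hY => i j; rewrite /two_scales; case: ifP => _.
  rewrite add0e lee_fin; have := hN n Nn; rewrite sub0r normrN => /ltW.
  exact: le_trans (ler_norm _).
by rewrite leeDl// lee_fin ltW.
Qed.

End ThreePoints.

(** The preimage under [quot_proj] of a quotient neighbourhood is open in [pyr_star], so convergence
    of representatives replaces convergence in the quotient. *)
Lemma quotient_slice_tends (R : realType) (g : pyr_quot R * Rpos R -> pyr_star R)
    (r : Rpos R) (S : nat -> pyr_star R) (S0 : pyr_star R) :
  (forall V, star_open V -> prod_open (g @^-1` V)) ->
  tends (fun n => sval (S n)) (sval S0) ->
  tends (fun n => sval (g (quot_proj (S n), r))) (sval (g (quot_proj S0, r))).
Proof.
move=> gcont SS0 U oU US0.
have oV : star_open [set P : pyr_star R | U (sval P)] by exists U.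
have [V [Or [[U' oU' VU'] _ VS0 Orr VO]]] := gcont _ oV (quot_proj S0) r US0.
have VE P : V (quot_proj P) <-> U' (sval P).
  by have := congr1 (fun A => A P) VU'; rewrite /= => ->.
have [N hN] := SS0 U' oU' (iffLR (VE _) VS0).
by exists N => n /hN/VE hn; exact: VO.
Qed.

Theorem theorem3p5 (R : realType) : ~ homeomorphic_star_prod R.
Proof.
move=> [h [g [_ gK _ gcont]]].
have ge0 (a : R) : 0 <= a -> (0 <= a%:E)%E by rewrite lee_fin.
have oo0 : (0 <= +oo :> \bar R)%E := leey _.
have n0 n : 0 <= n.+1%:R :> R by [].
have i0 n : 0 <= n.+1%:R^-1 :> R by [].
have i1 n : n.+1%:R^-1 <= 1 :> R by rewrite invf_le1// ler1n.
have oneR := ge0 1 ler01.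
pose P := pyr3_star (pyr3_oo_not_fixed (a0 := oneR) (b0 := oo0) ltr01).
pose Q := pyr3_star (pyr3_not_fixed (a0 := lexx 0%E) (b0 := oneR) ltr01 ler01).
have n1 n : 1 <= n.+1%:R :> R by rewrite ler1n.
(* Using [n.+1] keeps the short distance at most the long one, as [pyr3_not_fixed] asks. *)
pose A n := pyr3_star (pyr3_not_fixed (a0 := oneR) (b0 := ge0 _ (n0 n)) (ltr0Sn _ _) (n1 n)).
pose B n := pyr3_star (pyr3_not_fixed (a0 := ge0 _ (i0 n)) (b0 := oneR) ltr01 (i1 n)).
have AP : tends (fun n => sval (A n)) (sval P).
  apply: pconv_tends; apply: pyr3_cvg_oo => c.
  exists (Num.truncn c) => n cn; apply: (le_trans (ltW (truncnS_gt c))).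
  by rewrite ler_nat ltnS.
have BQ : tends (fun n => sval (B n)) (sval Q).
  by apply: pconv_tends; apply: pyr3_cvg_0; exact: cvg_harmonic.
have AB n : quot_proj (A n) = quot_proj (B n).
  apply/quot_proj_eq; apply: (orbit_pyr3_scale _ _ _ (s := n.+1%:R^-1)).
  - by rewrite invr_gt0.
  - by rewrite mule1.
  - by rewrite -EFinM mulVf.
pose r : Rpos R := exist _ 1 ltr01.
have gP := quotient_slice_tends (r := r) gcont AP.
have gQ := quotient_slice_tends (r := r) gcont BQ.
have gE : g (quot_proj P, r) = g (quot_proj Q, r).
  apply: eq_sig_hprop => [?|]; first exact: Prop_irrelevance.
  apply: tends_unique gP _; under eq_fun do rewrite AB; exact: gQ.
have := congr1 (fun z => (h z).1) gE; rewrite /= !gK /= => /quot_proj_eq.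
exact: orbit_pyr3_neq.
Qed.
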